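(* Let $n$ be a positive integer and let $k$ be a computable field of characteristic zero, with algebraic closure $\overline{k}$. Assume that the polynomial ring $k[x]$ is equipped with a factoring algorithm. Then, for finitely presented $k$-algebras $R = k\{X_1,\ldots,X_s\}/\langle f_1,\ldots,f_t\rangle$ which have been determined to have at most finitely many equivalence classes of irreducible $n$-dimensional representations, these equivalence classes can be effectively counted. That is, there is an algorithm which, given as input a finite presentation of such an algebra $R$ (the number $s$ of generators and elements $f_1,\ldots,f_t$ of the free associative $k$-algebra $k\{X_1,\ldots,X_s\}$), terminates and outputs the number of equivalence classes of irreducible $n$-dimensional representations $R \to M_n(\overline{k})$.
   Context: A field $k$ is computable if its elements can be effectively represented so that equality is decidable and the field operations are computable. A factoring algorithm for $k[x]$ is an algorithm which factors any given nonzero polynomial in $k[x]$ into irreducible polynomials over $k$. The integer $n$ and the field $k$ are fixed. $k\{X_1,\ldots,X_s\}$ denotes the free associative (noncommutative) unital $k$-algebra on $X_1,\ldots,X_s$, and $\langle f_1,\ldots,f_t\rangle$ denotes the two-sided ideal generated by $f_1,\ldots,f_t$; the algebra $R$ may be infinite dimensional over $k$. An $n$-dimensional representation of $R$ is a unital $k$-algebra homomorphism $\rho\colon R \to M_n(\overline{k})$, where $M_n(\overline{k})$ is the $k$-algebra of $n\times n$ matrices over $\overline{k}$. Two such representations $\rho,\rho'$ are equivalent if there exists $Q \in GL_n(\overline{k})$ such that $\rho'(X) = Q\rho(X)Q^{-1}$ for all $X \in R$. The representation $\rho$ is irreducible if $\overline{k}\,\rho(R) = M_n(\overline{k})$, i.e.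 the $\overline{k}$-linear span of the image of $\rho$ is all of $M_n(\overline{k})$. *)

(* Defs.v *)
From HB Require Import structures.
From mathcomp Require Import all_boot all_order all_algebra.
From mathcomp Require Import boolp classical_sets functions cardinality.
From mathcomp Require Import monalg.

Set Implicit Arguments.
Unset Strict Implicit.
Unset Printing Implicit Defensive.

Import GRing.Theory.
Local Open Scope ring_scope.

(* Partial recursive functions (Kleene).  Arities are not tracked: a program
   acts on a finite list of natural numbers, and a missing argument reads as
   0.  [eval p v y] means that p halts on v with output y. *)

Inductive murec : Type :=
| Zero
| Succ
| Proj of nat
| Comp of murec & seq murec
| Rec of murec & murec
| Mu of murec.

Inductive eval : murec -> seq nat -> nat -> Prop :=
| eval_zero v : eval Zero v 0%N
| eval_succ v : eval Succ v (nth 0%N v 0).+1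
| eval_proj i v : eval (Proj i) v (nth 0%N v i)
| eval_comp f gs v ws y :
    evals gs v ws -> eval f ws y -> eval (Comp f gs) v y
| eval_rec0 f g v y :
    eval f (behead v) y -> nth 0%N v 0 = 0%N -> eval (Rec f g) v y
| eval_recS f g m v z y :
    eval (Rec f g) (m :: v) z -> eval g [:: m, z & v] y ->
    eval (Rec f g) (m.+1 :: v) y
| eval_mu f v y (h : nat -> nat) :
    (forall z, (z < y)%N -> eval f (z :: v) (h z).+1) ->
    eval f (y :: v) 0%N -> eval (Mu f) v y
with evals : seq murec -> seq nat -> seq nat -> Prop :=
| evals_nil v : evals [::] v [::]
| evals_cons g gs v w ws :
    eval g v w -> evals gs v ws -> evals (g :: gs) v (w :: ws).

Scheme eval_mind := Minimality for eval Sort Prop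
  with evals_mind := Minimality for evals Sort Prop.

Lemma eval_inj p v y y' : eval p v y -> eval p v y' -> y = y'.
Proof.
move=> h; move: p v y h y'.
apply: (eval_mind (P := fun p v y => forall y', eval p v y' -> y = y')
  (P0 := fun gs v ws => forall ws', evals gs v ws' -> ws = ws')).
- by move=> v y' h; inversion h.
- by move=> v y' h; inversion h.
- by move=> i v y' h; inversion h.
- move=> f gs v ws y _ IHgs _ IHf y' h.
  inversion h as [| | |f' gs' v' ws' y0 hws hy| | |]; subst.
  by rewrite -(IHgs _ hws) in hy; exact: IHf.
- move=> f g v y _ IH v0 y' h.
  inversion h as [| | | |f' g' v' y0 hy hv|f' g' m v' z y0 hz hy|]; subst.
    exact: IH.
  by move: v0.
- move=> f g m v z y _ IHz _ IHy y' h.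
  inversion h as [| | | |f' g' v' y0 hy hv|f' g' m' v' z' y0 hz hy|]; subst => //.
  by rewrite -(IHz _ hz) in hy; exact: IHy.
- move=> f v y t _ IHt _ IH0 y' h.
  inversion h as [| | | | | |f' v' y0 t' ht' h0']; subst.
  case: (ltngtP y y') => // [lt|lt].
    by have := IH0 _ (ht' _ lt).
  by have := IHt _ lt _ h0'.
- by move=> v ws' h; inversion h.
- move=> g gs v w ws _ IHw _ IHws ws' h.
  inversion h as [|g' gs' v' w' ws0 hw hws]; subst.
  by rewrite (IHw _ hw) (IHws _ hws).
Qed.

(* Finite lists of naturals are coded by naturals through the bijection
   CodeSeq.code; nested lists are coded from the inside out. *)

Notation ncode := CodeSeq.code.
Definition ncode2 (l : seq (seq nat)) : nat := ncode [seq ncode x | x <- l].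

Section ComputableField.

Variables (k : fieldType) (nu : nat -> k).

(* [nu a] is the element of k named by a; an element may have several names.
   Every natural number is a name, which loses no generality when the set of
   names is decidable. *)

Definition computes1 (D : k -> Prop) (op : k -> k) : Prop :=
  exists p, forall a, D (nu a) -> exists2 c, eval p [:: a] c & nu c = op (nu a).

Definition computes2 (op : k -> k -> k) : Prop :=
  exists p, forall a b,
    exists2 c, eval p [:: a; b] c & nu c = op (nu a) (nu b).

Definition decides_eq : Prop :=
  exists p, forall a b, eval p [:: a; b] (nat_of_bool (nu a == nu b)).

Definition computable_field : Prop :=
  [/\ forall x, exists a, nu a = x,
      decides_eq,
      computes2 +%R /\ computes2 *%R
    & computes1 (fun _ => True) -%R /\ computes1 (fun x => x != 0) GRing.inv].

(* The polynomial with coefficients named by cs, constant term first. *)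
Definition poly_named (cs : seq nat) : {poly k} := Poly [seq nu c | c <- cs].

Definition factoring_algorithm (p : murec) : Prop :=
  forall cs, poly_named cs != 0 ->
  exists2 qs : seq (seq nat),
    eval p [:: ncode cs] (ncode2 qs) &
    (forall q, q \in qs -> irreducible_poly (poly_named q)) /\
    (poly_named cs %= \prod_(q <- qs) poly_named q)%R.

End ComputableField.

Notation free_alg k s := {malg k[{fmonom 'I_s}]}.

(* A name of an element of the free algebra: a list of terms, each made of a
   name of its coefficient and of a word in the variables (not necessarily
   distinct). *)
Notation alg_name s := (seq (nat * seq 'I_s)).

Section Names.

Variables (k : fieldType) (nu : nat -> k) (s : nat).

Definition alg_named (d : alg_name s) : free_alg k s :=
  \sum_(t <- d) << nu t.1 *g FMonom t.2 >>.

Definition alg_code (d : alg_name s) : nat :=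
  ncode2 [seq t.1 :: [seq nat_of_ord i | i <- t.2] | t <- d].

End Names.

Section TwoSidedIdeal.

Variables (A : nzRingType) (fs : seq A).

Definition in_ideal (x : A) : Prop :=
  exists2 c : seq (A * A * A),
    (forall t, t \in c -> t.1.2 \in fs) &
    x = \sum_(t <- c) t.1.1 * t.1.2 * t.2.

Definition ideal_of : pred A := fun x => `[< in_ideal x >].

Lemma ideal_ofP x : reflect (in_ideal x) (x \in ideal_of).
Proof. exact: asboolP. Qed.

Lemma ideal_of_closed : zmod_closed ideal_of.
Proof.
split; first by apply/ideal_ofP; exists [::] => //; rewrite big_nil.
move=> x y /ideal_ofP [c cfs ->] /ideal_ofP [d dfs ->]; apply/ideal_ofP.
exists (c ++ [seq (- t.1.1, t.1.2, t.2) | t <- d]).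
  by move=> t; rewrite mem_cat => /orP[/cfs//|/mapP[u /dfs ? ->]].
rewrite big_cat big_map /= -sumrN; congr (_ + _).
by apply: eq_bigr => t _; rewrite !mulNr.
Qed.

HB.instance Definition _ := GRing.isZmodClosed.Build A ideal_of ideal_of_closed.

Lemma ideal_ofMl a x : x \in ideal_of -> a * x \in ideal_of.
Proof.
move=> /ideal_ofP [c cfs ->]; apply/ideal_ofP.
exists [seq (a * t.1.1, t.1.2, t.2) | t <- c].
  by move=> t /mapP[u /cfs ? ->].
by rewrite big_map mulr_sumr; apply: eq_bigr => t _; rewrite !mulrA.
Qed.

Lemma ideal_ofMr a x : x \in ideal_of -> x * a \in ideal_of.
Proof.
move=> /ideal_ofP [c cfs ->]; apply/ideal_ofP.
exists [seq (t.1.1, t.1.2, t.2 * a) | t <- c].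
  by move=> t /mapP[u /cfs ? ->].
by rewrite big_map mulr_suml; apply: eq_bigr => t _; rewrite !mulrA.
Qed.

End TwoSidedIdeal.

(* The quotient of an algebra by a finitely generated two-sided ideal.  It may
   be the zero ring, so it is equipped with the structures of a possibly
   trivial ring and of a left module, and not with those of [lalgType]. *)

Section QuotientAlgebra.

Local Open Scope quotient_scope.

Variables (k : fieldType) (A : lalgType k) (fs : seq A).

Definition quot_alg : Type := Quotient.quot (GRing.ZmodClosed.clone A (ideal_of fs) _).

HB.instance Definition _ := Choice.on quot_alg.
HB.instance Definition _ := GRing.Zmodule.on quot_alg.
HB.instance Definition _ := EqQuotient.on quot_alg.

Definition qproj (x : A) : quot_alg := \pi_quot_alg x.
Definition qone : quot_alg := qproj 1.
Definition qmul (x y : quot_alg) : quot_alg := qproj (repr x * repr y).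
Definition qscale (a : k) (x : quot_alg) : quot_alg := qproj (a *: repr x).

Lemma qproj_eq x y : (qproj x = qproj y) <-> (x - y \in ideal_of fs).
Proof.
rewrite -Quotient.equivE; split=> [/eqP|h]; first by rewrite eqmodE.
by apply/eqP; rewrite eqmodE.
Qed.

Lemma qprojK (x : quot_alg) : qproj (repr x) = x.
Proof. exact: reprK. Qed.

Lemma qprojD x y : qproj (x + y) = qproj x + qproj y.
Proof. exact: Quotient.pi_add. Qed.

Lemma qprojM x y : qproj (x * y) = qmul (qproj x) (qproj y).
Proof.
apply/qproj_eq.
have hx : x - repr (qproj x) \in ideal_of fs by apply/qproj_eq; rewrite qprojK.
have hy : y - repr (qproj y) \in ideal_of fs by apply/qproj_eq; rewrite qprojK.
have -> : x * y - repr (qproj x) * repr (qproj y)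
        = (x - repr (qproj x)) * y + repr (qproj x) * (y - repr (qproj y)).
  by rewrite mulrBl mulrBr addrA subrK.
by apply: rpredD; [apply: ideal_ofMr | apply: ideal_ofMl].
Qed.

Lemma qprojZ a x : qproj (a *: x) = qscale a (qproj x).
Proof.
apply/qproj_eq.
have hx : x - repr (qproj x) \in ideal_of fs by apply/qproj_eq; rewrite qprojK.
by rewrite -scalerBr -mulr_algl ideal_ofMl.
Qed.

Lemma qmulA : associative qmul.
Proof.
move=> x y z; rewrite -[x]qprojK -[y]qprojK -[z]qprojK.
by rewrite -!qprojM mulrA.
Qed.

Lemma qmul1 : left_id qone qmul.
Proof. by move=> x; rewrite -[x]qprojK -qprojM mul1r. Qed.

Lemma qmulr1 : right_id qone qmul.
Proof. by move=> x; rewrite -[x]qprojK -qprojM mulr1. Qed.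

Lemma qmulDl : left_distributive qmul +%R.
Proof.
move=> x y z; rewrite -[x]qprojK -[y]qprojK -[z]qprojK.
by rewrite -qprojD -!qprojM -qprojD mulrDl.
Qed.

Lemma qmulDr : right_distributive qmul +%R.
Proof.
move=> x y z; rewrite -[x]qprojK -[y]qprojK -[z]qprojK.
by rewrite -qprojD -!qprojM -qprojD mulrDr.
Qed.

HB.instance Definition _ := GRing.Zmodule_isPzRing.Build quot_alg
  qmulA qmul1 qmulr1 qmulDl qmulDr.

Lemma qscaleA a b x : qscale a (qscale b x) = qscale (a * b) x.
Proof. by rewrite -[x]qprojK -!qprojZ scalerA. Qed.

Lemma qscale1 : left_id 1 qscale.
Proof. by move=> x; rewrite -[x]qprojK -qprojZ scale1r. Qed.

Lemma qscaleDr : right_distributive qscale +%R.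
Proof.
by move=> a x y; rewrite -[x]qprojK -[y]qprojK -qprojD -!qprojZ -qprojD scalerDr.
Qed.

Lemma qscaleDl x : {morph qscale^~ x : a b / a + b}.
Proof. by move=> a b; rewrite -[x]qprojK -!qprojZ -qprojD scalerDl. Qed.

HB.instance Definition _ := GRing.Zmodule_isLmodule.Build k quot_alg
  qscaleA qscale1 qscaleDr qscaleDl.

Lemma qproj_is_zmod_morphism : zmod_morphism qproj.
Proof.
move=> x y; apply: (addIr (qproj y)).
by rewrite -qprojD !subrK.
Qed.

HB.instance Definition _ :=
  GRing.isZmodMorphism.Build A quot_alg qproj qproj_is_zmod_morphism.

Lemma qproj_is_monoid_morphism : monoid_morphism qproj.
Proof. by split=> // x y; rewrite qprojM. Qed.

HB.instance Definition _ :=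
  GRing.isMonoidMorphism.Build A quot_alg qproj qproj_is_monoid_morphism.

HB.instance Definition _ :=
  GRing.isScalable.Build k A quot_alg *:%R qproj qprojZ.

End QuotientAlgebra.

Section Representations.

Variables (k : fieldType) (kbar : closedFieldType) (iota : {rmorphism k -> kbar}).

(* kbar is algebraically closed by its type; algebraicity over k is left. *)
Definition is_alg_closure : Prop := integralRange iota.

Variables (n s : nat) (fs : seq (free_alg k s)).
Let R := quot_alg fs.

Record representation := Representation {
  rep_fun :> {rmorphism R -> 'M[kbar]_n};
  rep_scale : scalable_for (iota \; *:%R) rep_fun
}.

Definition rep_equiv (rho rho' : representation) : Prop :=
  exists2 Q : 'M[kbar]_n, Q \in unitmx &
    forall x : R, rho' x = Q *m rho x *m invmx Q.

Definition rep_irreducible (rho : representation) : Prop :=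
  forall B : 'M[kbar]_n, exists c : seq (kbar * R),
    B = \sum_(t <- c) t.1 *: rho t.2.

Definition irr_classes : set (set representation) :=
  [set C | exists2 rho, rep_irreducible rho & C = [set rho' | rep_equiv rho rho']]%classic.

End Representations.

Arguments irr_classes {k kbar} iota n {s} fs.

(* Main.v *)
(* For fixed m, the m-tuples of pairwise inequivalent irreducible representations
   are described by polynomial equations over k in the entries of the images of
   the generators and in auxiliary coefficients: the relations hold, and each
   matrix unit of M_n^m is a combination of the images of the words, where words
   of length at most m n^2 + 1 suffice because the spans of the words of bounded
   length increase in a space of dimension m n^2.  So there are at least m classes
   if and only if this system is solvable over the algebraic closure of k.

   Both answers have certificates consisting of equational derivations over the
   named constants of k.  If the system is unsolvable, then 1 = 0 is derivable
   from it: otherwise a maximal consistent extension gives a field in which the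
   system is solvable, and solutions specialize to the algebraic closure.  If it
   is solvable, then a solution lies in k(t) for a primitive element t, and the
   equations are derivable from the minimal equation of t and the expressions of
   the unknowns as polynomials in t.  When the number of classes is finite, an
   unbounded search finds the m for which the system is solvable for m and not
   for m + 1. *)

Require Import Defs.
From HB Require Import structures.
From mathcomp Require Import all_boot all_order all_algebra.
From mathcomp Require Import boolp classical_sets functions cardinality.
From mathcomp Require Import monalg.
From mathcomp Require Import finmap zify ring separable.

Set Implicit Arguments.
Unset Strict Implicit.
Unset Printing Implicit Defensive.

(** * Recursively enumerable predicates *)

(** No elimination procedure is programmed. The program only checks equational derivations, and its
    existence follows from closure properties of [re] under connectives, bounded quantifiers and
    inductive generation; which derivations exist is settled by classical model constructions. The
    obstacle is uniformity: one program must serve all [s], [ds] and [m], so the system cannot be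
    written out as fixed terms. Hence entries of words, relations and partial sums get variables of
    their own, and the recursive equations defining them become hypotheses of the derivations, given
    by finitely many schemes. Nothing bounds the length of a derivation. The search ends because,
    for M classes, a certificate for M and a refutation for M + 1 both exist; it is correct because
    both kinds of evidence are sound for every m. *)

Section Programs.

Implicit Types (p f g : murec) (v : seq nat).

Lemma eval_comp1 f g v x y :
  eval g v x -> eval f [:: x] y -> eval (Comp f [:: g]) v y.
Proof. by move=> hg; apply: eval_comp; do !econstructor; exact: hg. Qed.

Lemma eval_comp2 f g1 g2 v x1 x2 y :
  eval g1 v x1 -> eval g2 v x2 -> eval f [:: x1; x2] y ->
  eval (Comp f [:: g1; g2]) v y.
Proof.
move=> h1 h2; apply: eval_comp.
by apply: evals_cons h1 _; apply: evals_cons h2 _; constructor.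
Qed.

Lemma eval_rec f g v (F : nat -> nat) :
    eval f v (F 0) -> (forall m, eval g [:: m, F m & v] (F m.+1)) ->
  forall n, eval (Rec f g) (n :: v) (F n).
Proof.
move=> hf hg; elim=> [|n IHn]; first exact: eval_rec0.
exact: eval_recS IHn (hg n).
Qed.

Lemma eval_min f v (F : nat -> nat) y :
    (forall z, eval f (z :: v) (F z)) -> F y = 0 ->
    (forall z, z < y -> F z != 0) ->
  eval (Mu f) v y.
Proof.
move=> hf Fy Fz; apply: (@eval_mu _ _ _ (fun z => (F z).-1)); last by rewrite -Fy.
by move=> z /Fz; rewrite -lt0n => /prednK ->.
Qed.

Definition add_prog := Rec (Proj 0) (Comp Succ [:: Proj 1]).
Definition pred_prog := Rec Zero (Proj 0).
(** Recursion runs on the first argument, so subtraction is obtained with its arguments exchanged;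
    [computable_sub] swaps them back. *)
Definition rsub_prog := Rec (Proj 0) (Comp pred_prog [:: Proj 1]).
Definition eq0_prog := Rec (Comp Succ [:: Zero]) Zero.
Definition odd_prog := Rec Zero (Comp eq0_prog [:: Proj 1]).
Definition half_prog := Rec Zero (Comp add_prog [:: Comp odd_prog [:: Proj 0]; Proj 1]).
Definition iter_half_prog := Rec (Proj 0) (Comp half_prog [:: Proj 1]).
Definition iter_double_prog := Rec (Proj 0) (Comp add_prog [:: Proj 1; Proj 1]).
Definition mul_prog := Rec Zero (Comp add_prog [:: Proj 1; Proj 2]).

Lemma eval_add a b : eval add_prog [:: a; b] (a + b).
Proof.
apply: (eval_rec (F := fun n => n + b)) => [|m]; first exact: eval_proj.
by apply: eval_comp1 (eval_succ _); exact: eval_proj.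
Qed.

Lemma eval_mul a b : eval mul_prog [:: a; b] (a * b).
Proof.
apply: (eval_rec (F := fun n => n * b)) => [|m]; first exact: eval_zero.
rewrite mulSn addnC.
by apply: eval_comp2 (eval_add _ _); exact: eval_proj.
Qed.

Lemma eval_pred a : eval pred_prog [:: a] a.-1.
Proof.
by apply: (eval_rec (F := predn)) => [|m]; [exact: eval_zero | exact: eval_proj].
Qed.

Lemma eval_rsub a b : eval rsub_prog [:: a; b] (b - a).
Proof.
apply: (eval_rec (F := fun n => b - n)) => [|m].
  by rewrite subn0; exact: eval_proj.
by rewrite subnS; apply: eval_comp1 (eval_pred _); exact: eval_proj.
Qed.

Lemma eval_eq0 a : eval eq0_prog [:: a] (a == 0).
Proof.
apply: (eval_rec (F := fun n => n == 0)) => [|m]; last exact: eval_zero.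
exact: eval_comp1 (eval_zero _) (eval_succ _).
Qed.

Lemma eval_odd a : eval odd_prog [:: a] (odd a).
Proof.
apply: (eval_rec (F := fun n => odd n)) => [|m]; first exact: eval_zero.
rewrite oddS -eqb0; apply: eval_comp1 (eval_eq0 _); exact: eval_proj.
Qed.

Lemma eval_half a : eval half_prog [:: a] a./2.
Proof.
apply: (eval_rec (F := half)) => [|m]; first exact: eval_zero.
rewrite /= uphalf_half; apply: eval_comp2 (eval_add _ _); last exact: eval_proj.
by apply: eval_comp1 (eval_odd _); exact: eval_proj.
Qed.

Lemma eval_iter_half n a : eval iter_half_prog [:: n; a] (iter n half a).
Proof.
apply: (eval_rec (F := fun n => iter n half a)) => [|m]; first exact: eval_proj.
by apply: eval_comp1 (eval_half _); exact: eval_proj.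
Qed.

Lemma eval_iter_double n a : eval iter_double_prog [:: n; a] (2 ^ n * a).
Proof.
apply: (eval_rec (F := fun n => 2 ^ n * a)) => [|m].
  by rewrite mul1n; exact: eval_proj.
rewrite expnS -mulnA mul2n -addnn.
by apply: eval_comp2 (eval_add _ _); exact: eval_proj.
Qed.

End Programs.

(* Through CodeSeq.code every natural number is a finite list of natural
   numbers, hence a binary tree: 0 is the leaf, and [scons], [shd], [stl] are
   the constructor and the destructors of the other trees.  The constructor is
   locked because the unary numbers coding small trees are too large to compute. *)
Definition scons : nat -> nat -> nat := locked (fun h t => 2 ^ h * t.*2.+1).
Definition shd (x : nat) : nat := head 0 (CodeSeq.decode x).
Definition stl (x : nat) : nat := ncode (behead (CodeSeq.decode x)).

Lemma scons_unlock h t : scons h t = 2 ^ h * t.*2.+1.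
Proof. by rewrite /scons -lock. Qed.

Lemma ncode_cons h s : ncode (h :: s) = scons h (ncode s).
Proof. by rewrite scons_unlock. Qed.

Lemma sconsE h t : scons h t = ncode (h :: CodeSeq.decode t).
Proof. by rewrite ncode_cons CodeSeq.decodeK. Qed.

Lemma decode_scons h t : CodeSeq.decode (scons h t) = h :: CodeSeq.decode t.
Proof. by rewrite sconsE CodeSeq.codeK. Qed.

Lemma shd_scons h t : shd (scons h t) = h.
Proof. by rewrite /shd decode_scons. Qed.

Lemma stl_scons h t : stl (scons h t) = t.
Proof. by rewrite /stl decode_scons /= CodeSeq.decodeK. Qed.

Definition sE := (shd_scons, stl_scons).

Lemma scons_neq0 h t : (scons h t == 0) = false.
Proof. by rewrite scons_unlock muln_eq0 expn_eq0. Qed.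

Lemma scons_hdtl x : x != 0 -> scons (shd x) (stl x) = x.
Proof.
rewrite -[x]CodeSeq.decodeK; case: (CodeSeq.decode x) => [//|h t] _.
by rewrite ncode_cons !sE.
Qed.

Lemma scons_inj h t h' t' : scons h t = scons h' t' -> h = h' /\ t = t'.
Proof. by move=> e; move: (f_equal shd e) (f_equal stl e); rewrite !sE. Qed.

Lemma ltn_scons_hd h t : h < scons h t.
Proof. by have := CodeSeq.ltn_code (h :: CodeSeq.decode t); rewrite -sconsE /= => /andP[]. Qed.

Lemma ltn_scons_tl h t : t < scons h t.
Proof.
rewrite scons_unlock (@leq_trans t.*2.+1) //; first by rewrite ltnS -addnn leq_addr.
by rewrite leq_pmull // expn_gt0.
Qed.

Lemma shd0 : shd 0 = 0. Proof. by []. Qed.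
Lemma stl0 : stl 0 = 0. Proof. by []. Qed.

Lemma shd_lt x : x != 0 -> shd x < x.
Proof. by move=> /scons_hdtl e; rewrite -{2}e; exact: ltn_scons_hd. Qed.

Lemma stl_lt x : x != 0 -> stl x < x.
Proof. by move=> /scons_hdtl e; rewrite -{2}e; exact: ltn_scons_tl. Qed.

Definition scons_prog :=
  Comp iter_double_prog
    [:: Proj 0; Comp Succ [:: Comp add_prog [:: Proj 1; Proj 1]]].
(** The head of a tree is the exponent of 2 in its code, found by searching for the first odd
    iterated half. The code 0 has none, so the summand testing for 0 stops the search at once
    there. *)
Definition shd_prog :=
  Mu (Comp eq0_prog [:: Comp add_prog [::
    Comp odd_prog [:: iter_half_prog]; Comp eq0_prog [:: Proj 1]]]).
Definition stl_prog :=
  Comp half_prog [:: Comp iter_half_prog [:: shd_prog; Proj 0]].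

Lemma eval_scons h t : eval scons_prog [:: h; t] (scons h t).
Proof.
rewrite scons_unlock -addnn.
apply: eval_comp2 (eval_iter_double _ _); first exact: eval_proj.
apply: eval_comp1 (eval_succ _).
by apply: eval_comp2 (eval_add _ _); exact: eval_proj.
Qed.

Lemma iter_half_scons h t z : z <= h ->
  iter z half (scons h t) = 2 ^ (h - z) * t.*2.+1.
Proof.
elim: z => [|z IHz] lt; first by rewrite subn0 /= scons_unlock.
rewrite iterS IHz 1?ltnW // subnS -[h - z]prednK ?subn_gt0 //.
by rewrite expnS -mulnA mul2n doubleK.
Qed.

Lemma eval_shd x : eval shd_prog [:: x] (shd x).
Proof.
pose F z := (odd (iter z half x) + (x == 0) == 0) : nat.
have ev z : eval (Comp eq0_prog [:: Comp add_prog [::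
    Comp odd_prog [:: iter_half_prog]; Comp eq0_prog [:: Proj 1]]]) [:: z; x] (F z).
  apply: eval_comp1 (eval_eq0 _); apply: eval_comp2 (eval_add _ _).
    by apply: eval_comp1 (eval_odd _); exact: eval_iter_half.
  by apply: eval_comp1 (eval_eq0 _); exact: eval_proj.
apply: (eval_min ev); rewrite /F; have [->//|x0] := eqVneq x 0.
  by rewrite -{2}(scons_hdtl x0) iter_half_scons // subnn mul1n oddS odd_double.
move=> z lt; rewrite -(scons_hdtl x0) iter_half_scons 1?ltnW //.
by rewrite -[_ - z]prednK ?subn_gt0 // expnS -mulnA mul2n odd_double.
Qed.

Lemma eval_stl x : eval stl_prog [:: x] (stl x).
Proof.
have -> : stl x = half (iter (shd x) half x).
  have [->//|x0] := eqVneq x 0.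
  rewrite -{3}(scons_hdtl x0) iter_half_scons // subnn mul1n.
  by rewrite /= uphalf_double.
apply: eval_comp1 (eval_half _).
apply: eval_comp2 (eval_iter_half _ _); [exact: eval_shd | exact: eval_proj].
Qed.

(** * Computable functions of one argument and their closure properties *)

Definition computable (f : nat -> nat) : Prop :=
  exists p, forall x, eval p [:: x] (f x).

Definition computable2 (F : nat -> nat -> nat) : Prop :=
  exists p, forall a b, eval p [:: a; b] (F a b).

Lemma computable_id : computable (fun x => x).
Proof. by exists (Proj 0) => x; exact: eval_proj. Qed.

Lemma computable_const c : computable (fun _ => c).
Proof.
elim: c => [|c [p hp]]; first by exists Zero => x; exact: eval_zero.
by exists (Comp Succ [:: p]) => x; apply: eval_comp1 (eval_succ _).
Qed.

Lemma computable_comp2 F f g : computable2 F -> computable f -> computable g ->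
  computable (fun x => F (f x) (g x)).
Proof.
move=> [P hP] [p hp] [q hq]; exists (Comp P [:: p; q]) => x.
exact: eval_comp2 (hp x) (hq x) (hP _ _).
Qed.

Lemma computable_comp F f : computable F -> computable f ->
  computable (fun x => F (f x)).
Proof.
move=> [P hP] [p hp]; exists (Comp P [:: p]) => x.
exact: eval_comp1 (hp x) (hP _).
Qed.

Lemma computable_S f : computable f -> computable (fun x => (f x).+1).
Proof. by apply: computable_comp; exists Succ => x; exact: eval_succ. Qed.

Lemma computable_scons f g : computable f -> computable g ->
  computable (fun x => scons (f x) (g x)).
Proof. apply: computable_comp2; exists scons_prog; exact: eval_scons. Qed.

Lemma computable_shd f : computable f -> computable (fun x => shd (f x)).
Proof. apply: computable_comp; exists shd_prog; exact: eval_shd. Qed.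

Lemma computable_stl f : computable f -> computable (fun x => stl (f x)).
Proof. apply: computable_comp; exists stl_prog; exact: eval_stl. Qed.

Lemma computable_add f g : computable f -> computable g ->
  computable (fun x => f x + g x).
Proof. apply: computable_comp2; exists add_prog; exact: eval_add. Qed.

Lemma computable_mul f g : computable f -> computable g ->
  computable (fun x => f x * g x).
Proof. apply: computable_comp2; exists mul_prog; exact: eval_mul. Qed.

Lemma computable_sub f g : computable f -> computable g ->
  computable (fun x => f x - g x).
Proof.
move=> hf hg; apply: (computable_comp2 (F := fun b a => a - b)) hg hf.
by exists rsub_prog; exact: eval_rsub.
Qed.

Lemma computable_eq0 f : computable f -> computable (fun x => f x == 0 : nat).
Proof.
apply: (computable_comp (F := fun x => x == 0 : nat)).
by exists eq0_prog; exact: eval_eq0.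
Qed.

Lemma computable_eq f g : computable f -> computable g ->
  computable (fun x => f x == g x : nat).
Proof.
move=> hf hg.
have -> : (fun x => f x == g x : nat) = fun x => (f x - g x) + (g x - f x) == 0.
  by apply: funext => x; rewrite addn_eq0 !subn_eq0 eqn_leq.
by apply: computable_eq0; apply: computable_add; apply: computable_sub.
Qed.

Lemma computable_negb (b : nat -> bool) : computable (fun x => b x : nat) ->
  computable (fun x => ~~ b x : nat).
Proof.
move=> hb; have -> : (fun x => ~~ b x : nat) = fun x => (b x == 0 :> nat) : nat.
  by apply: funext => x; rewrite eqb0.
exact: computable_eq0.
Qed.

Lemma computable_leq f g : computable f -> computable g ->
  computable (fun x => f x <= g x : nat).
Proof. by move=> hf hg; apply: computable_eq0; exact: computable_sub. Qed.

Lemma computable_if (b : nat -> bool) f g :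
    computable (fun x => b x : nat) -> computable f -> computable g ->
  computable (fun x => if b x then f x else g x).
Proof.
move=> hb hf hg.
have -> : (fun x => if b x then f x else g x)
        = fun x => b x * f x + (nat_of_bool (b x) == 0) * g x.
  by apply: funext => x; case: (b x); rewrite /= ?mul1n ?mul0n ?addn0.
apply: computable_add; apply: computable_mul => //; exact: computable_eq0.
Qed.

(** Several arguments enter through pairing: the hypothesis on [g] concerns its composite with the
    destructors of a nested pair. Later closure lemmas share this convention. *)
Lemma computable_rec n f (g : nat -> nat -> nat -> nat) :
    computable n -> computable f ->
    computable (fun u => g (shd u) (shd (stl u)) (stl (stl u))) ->
  computable (fun x => nat_rect _ (f x) (fun m z => g m z x) (n x)).
Proof.
move=> [N hN] [p hp] [q hq].
pose R := Rec p (Comp q [:: Comp scons_prog [:: Proj 0;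
                            Comp scons_prog [:: Proj 1; Proj 2]]]).
exists (Comp R [:: N; Proj 0]) => x.
apply: eval_comp2 (hN x) (eval_proj _ _) _.
apply: (eval_rec (F := nat_rect _ (f x) (fun m z => g m z x))) => [|m] /=.
  exact: hp.
set z := nat_rect _ _ _ _.
have := hq (scons m (scons z x)); rewrite !sE; apply: eval_comp1.
apply: eval_comp2 (eval_scons _ _); first exact: eval_proj.
by apply: eval_comp2 (eval_scons _ _); exact: eval_proj.
Qed.

Lemma computable_iter n g f : computable n -> computable f ->
    computable (fun u => g (shd u) (stl u)) ->
  computable (fun x => iter (n x) (g x) (f x)).
Proof.
move=> hn hf hg.
have -> : (fun x => iter (n x) (g x) (f x))
        = fun x => nat_rect _ (f x) (fun _ z => g x z) (n x).
  by apply: funext => x; elim: (n x) => //= m ->.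
apply: (computable_rec (g := fun _ z x => g x z)) => //.
have h2 : computable (fun u => stl (stl u)).
  by do 2!apply: computable_stl; exact: computable_id.
have h1 : computable (fun u => shd (stl u)).
  by apply: computable_shd; apply: computable_stl; exact: computable_id.
have := computable_comp hg (computable_scons h2 h1).
by congr computable; apply: funext => u; rewrite !sE.
Qed.

(* The [i]-th item of the list coded by [l], and 0 outside the list. *)
Definition snth (l i : nat) : nat := shd (iter i stl l).

Lemma iter_stl i l : iter i stl l = ncode (drop i (CodeSeq.decode l)).
Proof.
elim: i => [|i IHi]; first by rewrite drop0 CodeSeq.decodeK.
by rewrite iterS IHi /stl CodeSeq.codeK -drop1 drop_drop add1n.
Qed.

Lemma snthE l i : snth l i = nth 0 (CodeSeq.decode l) i.
Proof.
by rewrite /snth iter_stl /shd CodeSeq.codeK -nth0 nth_drop addn0.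
Qed.

Lemma computable_iter_stl f g : computable f -> computable g ->
  computable (fun x => iter (g x) stl (f x)).
Proof.
move=> hf hg; apply: (computable_iter (g := fun _ => stl)) => //.
by apply: computable_stl; apply: computable_stl; exact: computable_id.
Qed.

Lemma computable_snth f g : computable f -> computable g ->
  computable (fun x => snth (f x) (g x)).
Proof. by move=> hf hg; apply: computable_shd; exact: computable_iter_stl. Qed.

Lemma computable_bsum n (g : nat -> nat -> nat) : computable n ->
    computable (fun u => g (shd u) (stl u)) ->
  computable (fun x => \sum_(i < n x) g x i).
Proof.
move=> hn hg.
have -> : (fun x => \sum_(i < n x) g x i)
        = fun x => nat_rect _ 0 (fun m z => z + g x m) (n x).
  apply: funext => x; elim: (n x) => [|m IHm] /=; first by rewrite big_ord0.
  by rewrite big_ord_recr /= IHm.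
apply: (computable_rec (g := fun m z x => z + g x m)) => //.
  exact: computable_const.
apply: computable_add.
  by apply: computable_shd; apply: computable_stl; exact: computable_id.
have h2 : computable (fun u => stl (stl u)).
  by do 2!apply: computable_stl; exact: computable_id.
have h1 : computable (fun u => shd u).
  by apply: computable_shd; exact: computable_id.
have := computable_comp hg (computable_scons h2 h1).
by congr computable; apply: funext => u; rewrite !sE.
Qed.

(** Stated with a total computable check of a certificate y rather than with halting, so that
    certificates combine directly: pairs for conjunctions and existential quantifiers, lists for
    bounded universal ones. *)
Definition re (A : nat -> Prop) : Prop :=
  exists2 c : nat -> nat -> nat, computable (fun u => c (shd u) (stl u)) &
    forall x, A x <-> exists y, c x y = 0.

Lemma re_ext A B : (forall x, A x <-> B x) -> re A -> re B.
Proof. by move=> e [c hc h]; exists c => // x; rewrite -e h. Qed.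

Lemma re_comp A f : re A -> computable f -> re (fun x => A (f x)).
Proof.
move=> [c hc h] hf; exists (fun x y => c (f x) y) => [|x]; last exact: h.
have := computable_comp hc (computable_scons (computable_comp hf
  (computable_shd computable_id)) (computable_stl computable_id)).
by congr computable; apply: funext => u; rewrite !sE.
Qed.

Lemma re_app3 (A : nat -> nat -> nat -> Prop) f g h :
    re (fun u => A (shd u) (shd (stl u)) (stl (stl u))) ->
    computable f -> computable g -> computable h ->
  re (fun x => A (f x) (g x) (h x)).
Proof.
move=> hA hf hg hh.
have := re_comp hA (computable_scons hf (computable_scons hg hh)).
by apply: re_ext => x; rewrite !sE.
Qed.

Lemma re_dec f : computable f -> re (fun x => f x = 0).
Proof.
move=> hf; exists (fun x _ => f x) => [|x].
  by apply: computable_comp => //; apply: computable_shd; exact: computable_id.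
by split=> [|[]//]; exists 0.
Qed.

Lemma re_bool (b : nat -> bool) : computable (fun x => b x : nat) -> re b.
Proof.
move=> hb; apply: re_ext (re_dec (computable_eq0 hb)) => x /=.
by case: (b x).
Qed.

Lemma re_eq f g : computable f -> computable g -> re (fun x => f x = g x).
Proof.
move=> hf hg; have := re_bool (computable_eq hf hg).
by apply: re_ext => x; split=> /eqP.
Qed.

Lemma computable_env c f g : computable (fun u => c (shd u) (stl u)) ->
  computable f -> computable g -> computable (fun x => c (f x) (g x)).
Proof.
move=> hc hf hg; have := computable_comp hc (computable_scons hf hg).
by congr computable; apply: funext => u; rewrite !sE.
Qed.

Lemma re_and A B : re A -> re B -> re (fun x => A x /\ B x).
Proof.
move=> [c hc hA] [d hd hB]; exists (fun x y => c x (shd y) + d x (stl y)).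
  have hid := computable_id; have h1 := computable_shd hid.
  have h2 := computable_stl hid.
  by apply: computable_add; [apply: (computable_env hc) | apply: (computable_env hd)];
    try apply: computable_shd; try apply: computable_stl.
move=> x; rewrite hA hB; split=> [[[y hy] [z hz]]|[y /eqP]].
  by exists (scons y z); rewrite !sE hy hz.
by rewrite addn_eq0 => /andP[/eqP h1 /eqP h2]; split; eexists; eassumption.
Qed.

Lemma re_or A B : re A -> re B -> re (fun x => A x \/ B x).
Proof.
move=> [c hc hA] [d hd hB]; exists (fun x y => c x y * d x y).
  exact: computable_mul.
move=> x; rewrite hA hB; split=> [[] [y hy]|[y /eqP]].
- by exists y; rewrite hy.
- by exists y; rewrite hy muln0.
by rewrite muln_eq0 => /orP[] /eqP h; [left | right]; exists y.
Qed.

Lemma re_ex (A : nat -> nat -> Prop) : re (fun u => A (shd u) (stl u)) ->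
  re (fun x => exists z, A x z).
Proof.
move=> [c hc hA]; exists (fun x y => c (scons x (shd y)) (stl y)).
  have hid := computable_id; have h1 := computable_shd hid.
  have h2 := computable_stl hid.
  apply: (computable_env hc); last exact: computable_stl.
  by apply: computable_scons => //; exact: computable_shd.
move=> x; split=> [[z]|[y hy]].
  have := hA (scons x z); rewrite !sE => -> [y hy].
  by exists (scons z y); rewrite !sE.
exists (shd y); have := hA (scons x (shd y)); rewrite !sE => ->.
by exists (stl y).
Qed.

Lemma snth_mkseq (f : nat -> nat) n i : i < n -> snth (ncode (mkseq f n)) i = f i.
Proof. by move=> lt; rewrite snthE CodeSeq.codeK nth_mkseq. Qed.

(** A certificate is the list of certificates for all i below the bound; the sum of the checks is 0
    exactly when each one is. *)
Lemma re_bforall n (A : nat -> nat -> Prop) : computable n ->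
    re (fun u => A (shd u) (stl u)) ->
  re (fun x => forall i, i < n x -> A x i).
Proof.
move=> hn [c hc hA].
exists (fun x y => \sum_(i < n x) c (scons x i) (snth y i)).
  have hid := computable_id; have h1 := computable_shd hid.
  have h2 := computable_stl hid.
  have h := computable_bsum (n := fun u => n (shd u))
    (g := fun u i => c (scons (shd u) i) (snth (stl u) i)).
  apply: h; first exact: computable_comp.
  apply: (computable_env hc); last first.
    by apply: computable_snth => //; exact: computable_stl.
  by apply: computable_scons => //; exact: computable_shd.
move=> x; split=> [h|[y hy] i lti].
  have /choice[w hw] i : exists w, i < n x -> c (scons x i) w = 0.
    have [lt|] := boolP (i < n x); last by exists 0.
    have := hA (scons x i); rewrite !sE => e.
    by have /e[w hw] := h _ lt; exists w.
  exists (ncode (mkseq w (n x))); rewrite big1 // => i _.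
  by rewrite snth_mkseq ?hw.
have := hA (scons x i); rewrite !sE => ->; exists (snth y i).
by move: hy => /eqP; rewrite sum_nat_eq0 => /forallP/(_ (Ordinal lti))/eqP.
Qed.

(** * Inductively generated predicates *)

(** Every rule has exactly two premises, which fits [der]: hypotheses and ring axioms go into [Ax],
    its other three rules into [Step]. *)
Inductive ind (Ax : nat -> Prop) (Step : nat -> nat -> nat -> Prop) : nat -> Prop :=
| ind_ax x : Ax x -> ind Ax Step x
| ind_step x y z : ind Ax Step y -> ind Ax Step z -> Step x y z -> ind Ax Step x.

Section Derivations.

Variables (Ax : nat -> Prop) (Step : nat -> nat -> nat -> Prop).

Definition justified (d : nat -> nat) (i : nat) : Prop :=
  Ax (d i) \/ exists j k, [/\ j < i, k < i & Step (d i) (d j) (d k)].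

Definition derivation (s : seq nat) : Prop :=
  forall i, i < size s -> justified (nth 0 s) i.

Lemma derivation_ind s i : derivation s -> i < size s -> ind Ax Step (nth 0 s i).
Proof.
move=> hs; have [n] := ubnP i; elim: n i => // n IHn i /ltnSE le_in lt_is.
have [h|[j [k [lj lk hst]]]] := hs i lt_is; first exact: ind_ax.
by apply: ind_step hst; apply: IHn; lia.
Qed.

Lemma justified_ext d d' i : (forall j, j <= i -> d j = d' j) ->
  justified d i -> justified d' i.
Proof.
move=> e [h|[j [k [lj lk h]]]]; first by left; rewrite -e.
by right; exists j, k; rewrite -!e // ltnW.
Qed.

Lemma justified_shift d n i : justified (fun j => d (n + j)) i -> justified d (n + i).
Proof.
move=> [h|[j [k [lj lk h]]]]; first by left.
by right; exists (n + j), (n + k); split=> //; rewrite ltn_add2l.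
Qed.

Lemma derivation_cat s t : derivation s -> derivation t -> derivation (s ++ t).
Proof.
move=> hs ht i; rewrite size_cat; case: (ltnP i (size s)) => [lt _|le lt].
  by apply: justified_ext (hs _ lt) => j lej; rewrite nth_cat (leq_ltn_trans lej).
have lt' : i - size s < size t by lia.
rewrite -(subnKC le); apply: justified_shift; apply: justified_ext (ht _ lt').
by move=> j _; rewrite nth_cat ltnNge leq_addr /= addKn.
Qed.

Lemma ind_derivation x : ind Ax Step x -> exists2 s, derivation s & x \in s.
Proof.
elim=> [{}x hx|{}x y z _ [s hs ys] _ [t ht zt] hst].
  by exists [:: x]; rewrite ?inE // => -[|//] _; left.
exists (rcons (s ++ t) x); last by rewrite mem_rcons inE eqxx.
have hd := derivation_cat hs ht.
move=> i; rewrite size_rcons ltnS leq_eqVlt => /orP[/eqP ->|lt].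
  right; exists (index y (s ++ t)), (index z (s ++ t)).
  have ys' : y \in s ++ t by rewrite mem_cat ys.
  have zt' : z \in s ++ t by rewrite mem_cat zt orbT.
  rewrite !nth_rcons ltnn eqxx !index_mem ys' zt'; split=> //.
  by rewrite !nth_index.
by apply: justified_ext (hd _ lt) => j lej; rewrite nth_rcons (leq_ltn_trans lej).
Qed.

(** Flattening a derivation tree into a list leaves two existential quantifiers and a bounded
    universal one, under which [re] is closed. Entries past the end of the list read as 0 and must
    be justified too, so the length is not tested. *)
Lemma indE x : ind Ax Step x <->
  exists d i, snth d i = x /\ forall j, j < i.+1 -> justified (snth d) j.
Proof.
split=> [/ind_derivation[s hs xs]|[d [i [<- h]]]].
  exists (ncode s), (index x s); split=> [|j lej].
    by rewrite snthE CodeSeq.codeK nth_index.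
  have lt : j < size s by rewrite (leq_trans lej) // index_mem.
  by apply: justified_ext (hs _ lt) => k _; rewrite snthE CodeSeq.codeK.
have hs : derivation (mkseq (snth d) i.+1).
  move=> j; rewrite size_mkseq => lt; apply: justified_ext (h _ lt) => k lek.
  by rewrite nth_mkseq // (leq_ltn_trans lek).
have := derivation_ind (i := i) hs; rewrite size_mkseq nth_mkseq //.
exact.
Qed.

End Derivations.

Global Opaque shd stl.

Ltac computable_tac :=
  repeat first
  [ match goal with
    | |- computable (fun x => x) => exact: computable_id
    | |- computable shd => exact: (computable_shd computable_id)
    | |- computable stl => exact: (computable_stl computable_id)
    | |- computable (fun x => ?c) => exact: (computable_const c)
    | |- computable (fun x => shd _) => apply: computable_shd
    | |- computable (fun x => stl _) => apply: computable_stl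
    | |- computable (fun x => snth _ _) => apply: computable_snth
    | |- computable (fun x => iter _ stl _) => apply: computable_iter_stl
    | |- computable (fun x => scons _ _) => apply: computable_scons
    | |- computable (fun x => addn _ _) => apply: computable_add
    | |- computable (fun x => muln _ _) => apply: computable_mul
    | |- computable (fun x => subn _ _) => apply: computable_sub
    | |- computable (fun x => S _) => apply: computable_S
    | |- computable (fun x => nat_of_bool (eq_op _ _)) => apply: computable_eq
    | |- computable (fun x => nat_of_bool (negb _)) => apply: computable_negb
    | |- computable (fun x => nat_of_bool (leq _ _)) => apply: computable_leq
    | |- computable (fun x => if _ then _ else _) => apply: computable_if
    end ].

Ltac re_tac :=
  repeat (cbv beta; match goal with
  | |- re (fun x => _ /\ _) => apply: re_and
  | |- re (fun x => _ \/ _) => apply: re_or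
  | |- re (fun x => exists _, _) => apply: re_ex
  | |- re (fun x => _ = 0) => apply: re_dec
  | |- re (fun x => is_true _) => apply: re_bool
  | |- re (fun x => _ = _) => apply: re_eq
  | |- re (fun x => forall i, is_true (i < _) -> _) => apply: re_bforall
  end); cbv beta; computable_tac.

Lemma re_ind (Ax : nat -> nat -> Prop) (Step : nat -> nat -> nat -> nat -> Prop) :
    re (fun u => Ax (shd u) (stl u)) ->
    re (fun u => Step (shd u) (shd (stl u)) (shd (stl (stl u))) (stl (stl (stl u)))) ->
  re (fun u => ind (Ax (shd u)) (Step (shd u)) (stl u)).
Proof.
move=> hA hS.
have e u : (exists d i, snth d i = stl u /\ forall j, j < i.+1 ->
    Ax (shd u) (snth d j) \/ exists j' k, j' < j /\ k < j /\
      Step (shd u) (snth d j) (snth d j') (snth d k)) <->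
    ind (Ax (shd u)) (Step (shd u)) (stl u).
  rewrite indE; split=> -[d [i [e h]]]; exists d, i; split=> // j /h.
    by move=> [?|[j' [k [? [? ?]]]]]; [left | right; exists j', k].
  by move=> [?|[j' [k [? ? ?]]]]; [left | right; exists j', k].
apply: re_ext e _; re_tac.
  set f := (X in re X).
  have -> : f = fun u => (fun v => Ax (shd v) (stl v)) (scons (shd (shd (shd (shd u))))
     (snth (stl (shd (shd u))) (stl u))) by apply: funext => u; rewrite !sE.
  by apply: re_comp hA _; computable_tac.
set f := (X in re X).
(* Each quantifier crossed by [re_tac] pairs the environment with the new variable, here [d], [i],
   [j], [j'] and [k]; [g] reads the arguments of [Step] back from that nesting. *)
pose g u := scons (shd (shd (shd (shd (shd (shd u))))))
  (scons (snth (stl (shd (shd (shd (shd u))))) (stl (shd (shd u))))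
  (scons (snth (stl (shd (shd (shd (shd u))))) (stl (shd u)))
   (snth (stl (shd (shd (shd (shd u))))) (stl u)))).
have -> : f = fun u => (fun v => Step (shd v) (shd (stl v)) (shd (stl (stl v)))
    (stl (stl (stl v)))) (g u) by apply: funext => u; rewrite !sE.
by apply: re_comp hS _; rewrite /g; computable_tac.
Qed.
Import GRing.Theory.
Local Open Scope ring_scope.

(** * Equational derivations over a named field *)

(** Operations on names as total functions, so that they can occur in coded terms and be composed;
    [computable_field] gives programs whose outputs are only specified through the elements they
    name. *)
Record naming (k : fieldType) := Naming {
  named :> nat -> k;
  name_eq : nat -> nat -> bool;
  name_add : nat -> nat -> nat;
  name_mul : nat -> nat -> nat;
  name0 : nat;
  name1 : nat;
  named_surj : forall x, exists a, named a = x;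
  name_eqE : forall a b, name_eq a b = (named a == named b);
  name_addE : forall a b, named (name_add a b) = named a + named b;
  name_mulE : forall a b, named (name_mul a b) = named a * named b;
  name0E : named name0 = 0;
  name1E : named name1 = 1;
  computable_name_eq : computable2 (fun a b => name_eq a b : nat);
  computable_name_add : computable2 name_add;
  computable_name_mul : computable2 name_mul
}.

Lemma naming_of_computable (k : fieldType) (nu : nat -> k) :
  computable_field nu -> exists N : naming k, named N = nu.
Proof.
move=> [surj [pe he] [[pa ha] [pm hm]] _].
have /choice[f hf] a : exists f : nat -> nat,
    forall b, eval pa [:: a; b] (f b) /\ nu (f b) = nu a + nu b.
  suff /choice[f hf] b : exists c, eval pa [:: a; b] c /\ nu c = nu a + nu b.
    by exists f.
  by have [c h1 h2] := ha a b; exists c.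
have /choice[g hg] a : exists g : nat -> nat,
    forall b, eval pm [:: a; b] (g b) /\ nu (g b) = nu a * nu b.
  suff /choice[g hg] b : exists c, eval pm [:: a; b] c /\ nu c = nu a * nu b.
    by exists g.
  by have [c h1 h2] := hm a b; exists c.
have [z hz] := surj 0; have [o ho] := surj 1.
have h1 : computable2 (fun a b => nu a == nu b : nat) by exists pe.
have h2 : computable2 f by exists pa => a b; exact: (hf a b).1.
have h3 : computable2 g by exists pm => a b; exact: (hg a b).1.
by exists (@Naming k nu (fun a b => nu a == nu b) f g z o surj (fun _ _ => erefl)
  (fun a b => (hf a b).2) (fun a b => (hg a b).2) hz ho h1 h2 h3).
Qed.

(* Terms over the names of k, coded by natural numbers; a code whose head is at
   least 3 is a variable. *)
Definition tconst (c : nat) : nat := scons 0 c.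
Definition tadd (x y : nat) : nat := scons 1 (scons x y).
Definition tmul (x y : nat) : nat := scons 2 (scons x y).

Section Derivability.

Variables (k : fieldType) (N : naming k).

(** Opposites have no symbol: minus x is the product of x with a name of -1, and [ax_mul0] makes
    this an additive inverse. [ax_const] identifies the different names of one element. *)
Inductive ring_axiom : nat -> nat -> Prop :=
| ax_refl x : ring_axiom x x
| ax_addC x y : ring_axiom (tadd x y) (tadd y x)
| ax_addA x y z : ring_axiom (tadd x (tadd y z)) (tadd (tadd x y) z)
| ax_mulC x y : ring_axiom (tmul x y) (tmul y x)
| ax_mulA x y z : ring_axiom (tmul x (tmul y z)) (tmul (tmul x y) z)
| ax_mulDl x y z : ring_axiom (tmul (tadd x y) z) (tadd (tmul x z) (tmul y z))
| ax_add0 x : ring_axiom (tadd (tconst (name0 N)) x) x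
| ax_mul1 x : ring_axiom (tmul (tconst (name1 N)) x) x
| ax_mul0 x : ring_axiom (tmul (tconst (name0 N)) x) (tconst (name0 N))
| ax_const a b : name_eq N a b -> ring_axiom (tconst a) (tconst b)
| ax_constD a b :
    ring_axiom (tadd (tconst a) (tconst b)) (tconst (name_add N a b))
| ax_constM a b :
    ring_axiom (tmul (tconst a) (tconst b)) (tconst (name_mul N a b)).

(** The Euclidean rule replaces symmetry and transitivity, which follow from it and reflexivity;
    this leaves no rule with a single premise, as the format of [ind] demands. *)
Inductive der (E : nat -> nat -> Prop) : nat -> nat -> Prop :=
| der_hyp x y : E x y -> der E x y
| der_ring x y : ring_axiom x y -> der E x y
| der_eucl x y z : der E x y -> der E x z -> der E y z
| der_add x x' y y' : der E x x' -> der E y y' -> der E (tadd x y) (tadd x' y')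
| der_mul x x' y y' : der E x x' -> der E y y' -> der E (tmul x y) (tmul x' y').

Lemma der_refl E x : der E x x.
Proof. by apply: der_ring; exact: ax_refl. Qed.

Lemma der_sym E x y : der E x y -> der E y x.
Proof. by move=> h; apply: der_eucl h (der_refl _ _). Qed.

Lemma der_trans E x y z : der E x y -> der E y z -> der E x z.
Proof. by move=> /der_sym; exact: der_eucl. Qed.

Lemma der_sub (E E' : nat -> nat -> Prop) x y : (forall x y, E x y -> der E' x y) ->
  der E x y -> der E' x y.
Proof.
move=> h; elim=> {x y} [x y /h//|x y ?|x y z _ h1 _ h2|x x' y y' _ h1 _ h2|
  x x' y y' _ h1 _ h2]; [exact: der_ring|exact: der_eucl h1 h2|
  exact: der_add|exact: der_mul].
Qed.

Definition der_step (x y z : nat) : Prop :=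
  (exists a b c, [/\ y = scons a b, z = scons a c & x = scons b c]) \/
  (exists a a' b b', [/\ y = scons a a', z = scons b b' &
     x = scons (tadd a b) (tadd a' b') \/ x = scons (tmul a b) (tmul a' b')]).

Lemma der_ind_nat E x y : der E x y <->
  ind (fun u => E (shd u) (stl u) \/ exists a b, u = scons a b /\ ring_axiom a b)
      der_step (scons x y).
Proof.
split=> [|h].
  elim=> {x y} [x y h|x y h|x y z _ h1 _ h2|x x' y y' _ h1 _ h2|
      x x' y y' _ h1 _ h2].
  - by apply: ind_ax; left; rewrite !sE.
  - by apply: ind_ax; right; exists x, y.
  - by apply: ind_step h1 h2 _; left; exists x, y, z.
  - by apply: ind_step h1 h2 _; right; exists x, x', y, y'; split=> //; left.
  - by apply: ind_step h1 h2 _; right; exists x, x', y, y'; split=> //; right.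
suff main u : ind (fun u => E (shd u) (stl u) \/
    exists a b, u = scons a b /\ ring_axiom a b) der_step u ->
    der E (shd u) (stl u).
  by have := main _ h; rewrite !sE.
elim=> {u h} [u [h|[a [b [-> h]]]]|u y' z _ h1 _ h2].
- exact: der_hyp.
- by rewrite !sE; exact: der_ring.
move=> [[a [b [c [e1 e2 ->]]]]|[a [a' [b [b' [e1 e2 e]]]]]].
  by move: h1 h2; rewrite e1 e2 !sE; exact: der_eucl.
move: h1 h2; rewrite e1 e2 !sE => h1 h2.
by case: e => ->; rewrite !sE; [exact: der_add | exact: der_mul].
Qed.

End Derivability.

Ltac names_tac N :=
  have := computable_name_eq N; have := computable_name_add N;
  have := computable_name_mul N;
  let h1 := fresh in let h2 := fresh in let h3 := fresh in
  move=> h1 h2 h3;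
  repeat (computable_tac; match goal with
  | |- computable (fun x => name_add _ _ _) => apply: (computable_comp2 h2)
  | |- computable (fun x => name_mul _ _ _) => apply: (computable_comp2 h1)
  | |- computable (fun x => nat_of_bool (name_eq _ _ _)) =>
      apply: (computable_comp2 h3)
  end).

Ltac or_split_tac :=
  first [ by repeat eexists; eauto | left; by repeat eexists; eauto
        | right; or_split_tac ].

(* An inductive predicate is the disjunction of its clauses. *)
Ltac disjunction_tac :=
  split; [ let h := fresh in intro h;
    repeat match goal with
    | h : _ \/ _ |- _ => destruct h as [h|h]
    | h : exists _, _ |- _ => destruct h as [? h]
    | h : _ /\ _ |- _ => destruct h as [? h]
    end; subst; constructor; assumption
  | let h := fresh in intro h; destruct h; or_split_tac ].

Section DerivabilityRe.

Variables (k : fieldType) (N : naming k).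

Lemma re_ring_axiom : re (fun u => ring_axiom N (shd u) (stl u)).
Proof.
pose A (x y : nat) := x = y
  \/ (exists a b, x = tadd a b /\ y = tadd b a)
  \/ (exists a b c, x = tadd a (tadd b c) /\ y = tadd (tadd a b) c)
  \/ (exists a b, x = tmul a b /\ y = tmul b a)
  \/ (exists a b c, x = tmul a (tmul b c) /\ y = tmul (tmul a b) c)
  \/ (exists a b c, x = tmul (tadd a b) c /\ y = tadd (tmul a c) (tmul b c))
  \/ x = tadd (tconst (name0 N)) y
  \/ x = tmul (tconst (name1 N)) y
  \/ (exists a, x = tmul (tconst (name0 N)) a /\ y = tconst (name0 N))
  \/ (exists a b, name_eq N a b /\ x = tconst a /\ y = tconst b)
  \/ (exists a b, x = tadd (tconst a) (tconst b) /\ y = tconst (name_add N a b))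
  \/ (exists a b, x = tmul (tconst a) (tconst b) /\ y = tconst (name_mul N a b)).
have e x y : A x y <-> ring_axiom N x y.
  by rewrite /A; disjunction_tac.
apply: (re_ext (A := fun u => A (shd u) (stl u))) => [u|]; first exact: e.
rewrite /A /tadd /tmul /tconst.
by re_tac; names_tac N.
Qed.

Lemma re_der (E : nat -> nat -> nat -> Prop) f g h :
    re (fun u => E (shd u) (shd (stl u)) (stl (stl u))) ->
    computable f -> computable g -> computable h ->
  re (fun x => der N (E (f x)) (g x) (h x)).
Proof.
move=> hE hf hg hh.
have hi : re (fun u => ind (fun v => E (shd u) (shd v) (stl v) \/
    exists a b, v = scons a b /\ ring_axiom N a b) der_step (stl u)).
  apply: (re_ind (Ax := fun p v => E p (shd v) (stl v) \/
    exists a b, v = scons a b /\ ring_axiom N a b) (Step := fun _ => der_step)).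
    re_tac; last first.
      by apply: (re_ext (A := fun u => ring_axiom N (shd (scons (stl (shd u)) (stl u)))
        (stl (scons (stl (shd u)) (stl u)))));
        [move=> u; rewrite !sE | apply: (re_comp re_ring_axiom); computable_tac].
    exact: hE.
  rewrite /der_step /tadd /tmul.
  apply: (re_ext (A := fun u : nat => (exists a b c : nat, shd (stl (stl u)) = scons a b /\
     stl (stl (stl u)) = scons a c /\ shd (stl u) = scons b c) \/
   (exists a a' b b' : nat, shd (stl (stl u)) = scons a a' /\
      stl (stl (stl u)) = scons b b' /\ (shd (stl u) =
       scons (scons 1 (scons a b)) (scons 1 (scons a' b')) \/
       shd (stl u) = scons (scons 2 (scons a b)) (scons 2 (scons a' b')))))).
    move=> u; split=> -[|].
    - by move=> [a [b [c [? [? ?]]]]]; left; exists a, b, c.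
    - by move=> [a [b [c [d [? [? ?]]]]]]; right; exists a, b, c, d.
    - by move=> [a [b [c [? ? ?]]]]; left; exists a, b, c.
    - by move=> [a [b [c [d [? ? ?]]]]]; right; exists a, b, c, d.
  by re_tac.
apply: (re_ext _ (re_comp hi (computable_scons hf (computable_scons hg hh)))) => x.
by rewrite !sE -der_ind_nat.
Qed.

End DerivabilityRe.

Local Open Scope nat_scope.

(** * Equations describing tuples of representations *)

(* The variables of the coded terms: [vbase 0] is a parameter t and [vpoly e l]
   the polynomial in t with coefficient list l and leading term e t^|l|;
   [vent p a i j] is the (i, j) entry of the image of the a-th generator under
   the p-th representation, [vcoef q w] the coefficient of the word w in the
   q-th linear combination of words; [vword], [vrel] and [vsum] are the entries
   of the images of a word, of an element of the free algebra, and of a partial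
   sum of a linear combination of words. *)
Definition vbase (v : nat) : nat := scons 3 v.
Definition vpoly (e l : nat) : nat := scons 4 (scons e l).
Definition ient (p a i j : nat) : nat := scons 0 (scons p (scons a (scons i j))).
Definition icoef (q w : nat) : nat := scons 1 (scons q w).
Definition vent (p a i j : nat) : nat := vbase (ient p a i j).
Definition vcoef (q w : nat) : nat := vbase (icoef q w).
Definition vword (p w i j : nat) : nat := scons 5 (scons p (scons w (scons i j))).
Definition vrel (p d i j : nat) : nat := scons 6 (scons p (scons d (scons i j))).
Definition vsum (q w p i j : nat) : nat :=
  scons 7 (scons q (scons w (scons p (scons i j)))).
Definition unit_index (p i j : nat) : nat := scons p (scons i j).

Section System.

Variables (k : fieldType) (N : naming k) (n : nat).

Definition tsum (m : nat) (f : nat -> nat) : nat :=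
  foldr (fun l t => tadd (f l) t) (tconst (name0 N)) (iota 0 m).
Definition tbool (b : bool) : nat := tconst (if b then name1 N else name0 N).

(** [vsum] runs over all numbers below a bound, hence over words with arbitrary letters;
    [def_word_out] makes words with a letter outside the alphabet contribute 0. *)
Inductive def_eq (s : nat) : nat -> nat -> Prop :=
| def_poly0 e : def_eq s (vpoly e 0) (tconst e)
| def_polyS e c l : def_eq s (vpoly e (scons c l))
    (tadd (tconst c) (tmul (vbase 0) (vpoly e l)))
| def_word0 p i j : def_eq s (vword p 0 i j) (tbool (i == j))
| def_wordS p a w i j : a < s -> def_eq s (vword p (scons a w) i j)
    (tsum n (fun l => tmul (vent p a i l) (vword p w l j)))
| def_word_out p a w i j : s <= a ->
    def_eq s (vword p (scons a w) i j) (tbool false)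
| def_rel0 p i j : def_eq s (vrel p 0 i j) (tbool false)
| def_relS p t d i j : def_eq s (vrel p (scons t d) i j)
    (tadd (tmul (tconst (shd t)) (vword p (stl t) i j)) (vrel p d i j))
| def_sum0 q p i j : def_eq s (vsum q 0 p i j) (tbool false)
| def_sumS q w p i j : def_eq s (vsum q w.+1 p i j)
    (tadd (vsum q w p i j) (tmul (vcoef q w) (vword p w i j))).

(* Larger than the codes of all words of length at most m n^2 + 1 in s letters. *)
Definition word_bound (s m : nat) : nat := (iter (m * (n * n)).+2 (scons s) 0).+1.

(** The condition on [iter t stl ds] says that t indexes an item of the list of relations, since the
    nonzero numbers are the codes of nonempty lists. *)
Inductive con_eq (s ds m : nat) : nat -> nat -> Prop :=
| con_rel t p i j : iter t stl ds != 0 -> p < m -> i < n -> j < n ->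
    con_eq s ds m (vrel p (snth ds t) i j) (tbool false)
| con_sum p' i' j' p i j : p' < m -> i' < n -> j' < n -> p < m -> i < n -> j < n ->
    con_eq s ds m (vsum (unit_index p' i' j') (word_bound s m) p i j)
      (tbool (unit_index p' i' j' == unit_index p i j)).

Definition upper_eq (s ds m x y : nat) : Prop := def_eq s x y \/ con_eq s ds m x y.

(** The polynomial for t is monic by its leading constant [name1], and the condition [r != 0] of
    [certified] gives it positive degree, so these equations are satisfiable in an algebraically
    closed field whatever r and h are. Codes of entries and coefficients are pairs, hence nonzero:
    this leaves [vbase 0] free for t and explains the successor. *)
Definition lower_eq (s r h x y : nat) : Prop :=
  def_eq s x y \/ (x = vpoly (name1 N) r /\ y = tbool false) \/
  (exists v, x = vbase v.+1 /\ y = vpoly (name0 N) (snth h v.+1)).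

(* A derivation of [1 = 0] shows that the system for m representations has no
   solution; a solution is certified by an equation making t algebraic, and by
   polynomials in t whose substitution for the base variables makes every
   equation derivable. *)
Definition refutable (s ds m : nat) : Prop :=
  der N (upper_eq s ds m) (tbool true) (tbool false).

Definition certified (s ds m : nat) : Prop :=
  exists r h, r != 0 /\ forall x y, con_eq s ds m x y -> der N (lower_eq s r h) x y.

Lemma computable_tsum m f : (forall l, computable (f l)) ->
  computable (fun x => tsum m (fun l => f l x)).
Proof.
move=> hf; rewrite /tsum; elim: (iota 0 m) => [|l t IHt] /=.
  exact: computable_const.
rewrite /tadd; computable_tac => //.
Qed.

Lemma re_def_eq : re (fun u => def_eq (shd u) (shd (stl u)) (stl (stl u))).
Proof.
pose A (s x y : nat) := (exists e, x = vpoly e 0 /\ y = tconst e) \/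
  (exists e c l, x = vpoly e (scons c l) /\
     y = tadd (tconst c) (tmul (vbase 0) (vpoly e l))) \/
  (exists p i j, x = vword p 0 i j /\ y = tbool (i == j)) \/
  (exists p a w i j, a < s /\ x = vword p (scons a w) i j /\
     y = tsum n (fun l => tmul (vent p a i l) (vword p w l j))) \/
  (exists p a w i j, s <= a /\ x = vword p (scons a w) i j /\ y = tbool false) \/
  (exists p i j, x = vrel p 0 i j /\ y = tbool false) \/
  (exists p t d i j, x = vrel p (scons t d) i j /\
     y = tadd (tmul (tconst (shd t)) (vword p (stl t) i j)) (vrel p d i j)) \/
  (exists q p i j, x = vsum q 0 p i j /\ y = tbool false) \/
  (exists q w p i j, x = vsum q w.+1 p i j /\
     y = tadd (vsum q w p i j) (tmul (vcoef q w) (vword p w i j))).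
have e s x y : A s x y <-> def_eq s x y.
  by rewrite /A; disjunction_tac.
apply: (re_ext (A := fun u => A (shd u) (shd (stl u)) (stl (stl u)))) => [u|].
  exact: e.
rewrite /A /vpoly /vword /vrel /vsum /vent /vcoef /vbase /ient /icoef /tbool /tmul.
re_tac; try (rewrite /tadd /tconst; computable_tac).
by apply: (@computable_tsum _ (fun l x => _)) => l; computable_tac.
Qed.

Lemma computable_word_bound f g : computable f -> computable g ->
  computable (fun x => word_bound (f x) (g x)).
Proof.
move=> hf hg; rewrite /word_bound; apply: computable_S.
apply: (computable_iter (g := fun x => scons (f x))); computable_tac => //.
by apply: (computable_comp hf); computable_tac.
Qed.

Lemma re_con_eq : re (fun u => con_eq (shd u) (shd (stl u)) (shd (stl (stl u)))
  (shd (stl (stl (stl u)))) (stl (stl (stl (stl u))))).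
Proof.
pose A (s ds m x y : nat) :=
  (exists t p i j, iter t stl ds != 0 /\ p < m /\ i < n /\ j < n /\
    x = vrel p (snth ds t) i j /\ y = tbool false) \/
  (exists p' i' j' p i j, p' < m /\ i' < n /\ j' < n /\ p < m /\ i < n /\ j < n /\
    x = vsum (unit_index p' i' j') (word_bound s m) p i j /\
    y = tbool (unit_index p' i' j' == unit_index p i j)).
have e s ds m x y : A s ds m x y <-> con_eq s ds m x y.
  by rewrite /A; disjunction_tac.
apply: (re_ext (A := fun u => A (shd u) (shd (stl u)) (shd (stl (stl u)))
  (shd (stl (stl (stl u)))) (stl (stl (stl (stl u)))))) => [u|]; first exact: e.
rewrite /A /vrel /vsum /unit_index /tbool /tconst; re_tac.
by apply: computable_word_bound; computable_tac.
Qed.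

Lemma re_refutable f g h : computable f -> computable g -> computable h ->
  re (fun x => refutable (f x) (g x) (h x)).
Proof.
move=> hf hg hh; rewrite /refutable.
pose E p := upper_eq (shd p) (shd (stl p)) (stl (stl p)).
apply: (re_ext (A := fun x => der N (E (scons (f x) (scons (g x) (h x))))
  (tbool true) (tbool false))) => [x|]; first by rewrite /E !sE.
apply: re_der; rewrite /tbool; computable_tac => //.
rewrite /E /upper_eq; apply: re_or.
  by apply: (re_app3 re_def_eq); computable_tac.
apply: (re_ext _ (re_comp re_con_eq (f := fun u => scons (shd (shd u))
  (scons (shd (stl (shd u))) (scons (stl (stl (shd u)))
   (scons (shd (stl u)) (stl (stl u)))))) _)); last by computable_tac.
by move=> u; rewrite !sE.
Qed.

(** Makes the quantifier over relations in [re_certified] a bounded one. *)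
Lemma iter_stl_neq0 t l : iter t stl l != 0 -> t < l.
Proof.
move=> h; have lt : t < size (CodeSeq.decode l).
  by rewrite ltnNge; apply: contraNN h => le; rewrite iter_stl drop_oversize.
apply: (leq_trans lt); rewrite -{2}[l]CodeSeq.decodeK.
elim: (CodeSeq.decode l) => // a d IHd; apply: (leq_ltn_trans IHd).
by rewrite ncode_cons ltn_scons_tl.
Qed.

Lemma re_certified f g h : computable f -> computable g -> computable h ->
  re (fun x => certified (f x) (g x) (h x)).
Proof.
move=> hf hg hh; rewrite /certified.
pose E p := lower_eq (shd p) (shd (stl p)) (stl (stl p)).
have hE : re (fun u => E (shd u) (shd (stl u)) (stl (stl u))).
  rewrite /E /lower_eq; apply: re_or; last first.
    by rewrite /tbool /vpoly /vbase /tconst; re_tac.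
  by apply: (re_app3 re_def_eq); computable_tac.
(* [con_eq] is unfolded into bounded quantifiers; its side condition on t becomes a disjunct because
   [re] is not closed under implication. *)
pose P s ds m := exists r h, r != 0 /\
  (forall t, t < ds -> forall p, p < m -> forall i, i < n -> forall j, j < n ->
    iter t stl ds = 0 \/ der N (E (scons s (scons r h)))
      (vrel p (snth ds t) i j) (tbool false)) /\
  (forall p', p' < m -> forall i', i' < n -> forall j', j' < n ->
   forall p, p < m -> forall i, i < n -> forall j, j < n ->
   der N (E (scons s (scons r h)))
    (vsum (unit_index p' i' j') (word_bound s m) p i j)
    (tbool (unit_index p' i' j' == unit_index p i j))).
have eP s ds m : P s ds m <-> certified s ds m.
  split=> -[r [h' [r0 H]]]; exists r, h'; split=> //.
    case: H => H1 H2 x y [t p i j h1 h2 h3 h4|p' i' j' p i j h1 h2 h3 h4 h5 h6].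
      case: (H1 t _ p h2 i h3 j h4) => [|e|]; last by rewrite /E !sE.
        exact: iter_stl_neq0.
      by rewrite e in h1.
    by have := H2 p' h1 i' h2 j' h3 p h4 i h5 j h6; rewrite /E !sE.
  split=> [t ht p hp i hi j hj|p' hp' i' hi' j' hj' p hp i hi j hj].
    have [->|t0] := eqVneq (iter t stl ds) 0; [by left | right].
    by rewrite /E !sE; apply: H; constructor.
  by rewrite /E !sE; apply: H; constructor.
apply: (re_ext (A := fun x => P (f x) (g x) (h x))) => [x|]; first exact: eP.
apply: (@re_app3 P) => //.
rewrite /P; re_tac; (apply: re_der; first exact: hE);
  rewrite /vrel /vsum /tbool /unit_index /tconst; computable_tac.
by apply: computable_word_bound; computable_tac.
Qed.

(** Minimization over numbers [w] that code a value of m together with a certificate for both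
    conditions; the check is total, so no trial diverges. The value found may differ from the given
    m as far as this lemma is concerned. *)
Lemma counting_program : exists P : murec, forall s ds m,
    certified s ds m -> refutable s ds m.+1 ->
    exists m', [/\ eval P [:: s; ds] m', certified s ds m' & refutable s ds m'.+1].
Proof.
have [c [p hp] hc] : re (fun u => certified (shd (shd u)) (stl (shd u)) (stl u) /\
    refutable (shd (shd u)) (stl (shd u)) (stl u).+1).
  by apply: re_and; [apply: re_certified | apply: re_refutable]; computable_tac.
pose T := Comp p [:: Comp scons_prog [:: Comp scons_prog [::
  Comp scons_prog [:: Proj 1; Proj 2]; Comp shd_prog [:: Proj 0]];
  Comp stl_prog [:: Proj 0]]].
pose F s ds w := c (scons (scons s ds) (shd w)) (stl w).
have hT s ds w : eval T [:: w; s; ds] (F s ds w).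
  have := hp (scons (scons (scons s ds) (shd w)) (stl w)); rewrite !sE.
  apply: eval_comp1; apply: eval_comp2 (eval_scons _ _); last first.
    by apply: eval_comp1 (eval_stl _); exact: eval_proj.
  apply: eval_comp2 (eval_scons _ _); last first.
    by apply: eval_comp1 (eval_shd _); exact: eval_proj.
  by apply: eval_comp2 (eval_scons _ _); exact: eval_proj.
exists (Comp shd_prog [:: Mu T]) => s ds m hm hm1.
have hex : exists w, F s ds w == 0.
  have [y hy] : exists y, c (scons (scons s ds) m) y = 0.
    by apply/hc; rewrite !sE.
  by exists (scons m y); rewrite /F !sE hy.
pose w := ex_minn hex.
have [hw wmin] : F s ds w = 0 /\ forall z, z < w -> F s ds z != 0.
  rewrite /w; case: ex_minnP => {}w /eqP hw hmin; split=> // z.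
  by apply: contraL => /hmin; rewrite -leqNgt.
exists (shd w); have /hc : exists y, c (scons (scons s ds) (shd w)) y = 0.
  by exists (stl w).
rewrite !sE => -[h1 h2]; split=> //.
by apply: eval_comp1 (eval_shd _); apply: eval_min (hT s ds) _ _.
Qed.

End System.
Local Open Scope ring_scope.

(** * Values of coded terms in commutative rings *)

Section Semantics.

Variables (k : fieldType) (N : naming k) (n s : nat).

Section Values.

Variables (A : comNzRingType) (c : {rmorphism k -> A}) (b : nat -> A).

Definition val_poly (e : nat) (l : seq nat) : A :=
  foldr (fun a z => c (N a) + b 0 * z) (c (N e)) l.

Definition val_word (p : nat) (w : seq nat) : nat -> nat -> A :=
  foldr (fun a f i j =>
      if (a < s)%N then \sum_(l < n) b (ient p a i l) * f (l : nat) j else 0)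
    (fun i j => (i == j)%:R) w.

Definition val_rel (p : nat) (d : seq nat) (i j : nat) : A :=
  \sum_(t <- d) c (N (shd t)) * val_word p (CodeSeq.decode (stl t)) i j.

Definition val_sum (q w p i j : nat) : A :=
  \sum_(u < w) b (icoef q u) * val_word p (CodeSeq.decode u) i j.

Definition val_var (x : nat) : A :=
  let y := stl x in
  match shd x with
  | 3 => b y
  | 4 => val_poly (shd y) (CodeSeq.decode (stl y))
  | 5 => val_word (shd y) (CodeSeq.decode (shd (stl y)))
           (shd (stl (stl y))) (stl (stl (stl y)))
  | 6 => val_rel (shd y) (CodeSeq.decode (shd (stl y)))
           (shd (stl (stl y))) (stl (stl (stl y)))
  | 7 => val_sum (shd y) (shd (stl y)) (shd (stl (stl y)))
           (shd (stl (stl (stl y)))) (stl (stl (stl (stl y))))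
  | _ => 0
  end.

(** Subterms are obtained by decoding and not structurally, hence the fuel; [x.+1] is enough, since
    subterms have smaller codes. Heads from 3 on are variables, whose intended values [val_var]
    gives directly. *)
Fixpoint val_rec (f x : nat) : A :=
  if f is f'.+1 then
    match shd x with
    | 0 => c (N (stl x))
    | 1 => val_rec f' (shd (stl x)) + val_rec f' (stl (stl x))
    | 2 => val_rec f' (shd (stl x)) * val_rec f' (stl (stl x))
    | _ => val_var x
    end
  else 0.

Definition value (x : nat) : A := val_rec x.+1 x.

Lemma val_rec_fuel f f' x : (x < f)%N -> (x < f')%N -> val_rec f x = val_rec f' x.
Proof.
elim: f f' x => [|f IHf] [|f'] x //=; rewrite !ltnS => le le'.
have [x0|x0] := eqVneq x 0%N; first by rewrite x0 shd0.
have lt1 : (stl (stl x) <= stl x)%N.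
  by have [->|/stl_lt/ltnW //] := eqVneq (stl x) 0%N; rewrite stl0.
have lt2 : (shd (stl x) <= stl x)%N.
  by have [->|/shd_lt/ltnW //] := eqVneq (stl x) 0%N; rewrite shd0.
have lt := stl_lt x0.
case: (shd x) => [//|[|[|//]]]; rewrite ?(IHf f' (shd (stl x)))
  ?(IHf f' (stl (stl x))) //; lia.
Qed.

Lemma val_tconst a : value (tconst a) = c (N a).
Proof. by rewrite /value /= !sE. Qed.

Lemma val_tadd x y : value (tadd x y) = value x + value y.
Proof.
rewrite /value [LHS]/= !sE; congr (_ + _); apply: val_rec_fuel => //.
  exact: ltn_trans (ltn_scons_hd _ _) (ltn_scons_tl _ _).
exact: ltn_trans (ltn_scons_tl _ _) (ltn_scons_tl _ _).
Qed.

Lemma val_tmul x y : value (tmul x y) = value x * value y.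
Proof.
rewrite /value [LHS]/= !sE; congr (_ * _); apply: val_rec_fuel => //.
  exact: ltn_trans (ltn_scons_hd _ _) (ltn_scons_tl _ _).
exact: ltn_trans (ltn_scons_tl _ _) (ltn_scons_tl _ _).
Qed.

Lemma val_vbase v : value (vbase v) = b v.
Proof. by rewrite /value /= /val_var !sE. Qed.

Lemma val_vpoly e l : value (vpoly e l) = val_poly e (CodeSeq.decode l).
Proof. by rewrite /value /= /val_var !sE. Qed.

Lemma val_vword p w i j : value (vword p w i j) = val_word p (CodeSeq.decode w) i j.
Proof. by rewrite /value /= /val_var !sE. Qed.

Lemma val_vrel p d i j : value (vrel p d i j) = val_rel p (CodeSeq.decode d) i j.
Proof. by rewrite /value /= /val_var !sE. Qed.

Lemma val_vsum q w p i j : value (vsum q w p i j) = val_sum q w p i j.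
Proof. by rewrite /value /= /val_var !sE. Qed.

Lemma val_tbool (B : bool) : value (tbool N B) = B%:R.
Proof.
by rewrite val_tconst; case: B; rewrite ?name1E ?name0E ?rmorph1 ?rmorph0.
Qed.

(* A function on codes which interprets the operations and satisfies the
   defining equations is determined by the values of the base variables. *)
Section Model.

Variable phi : nat -> A.
Hypotheses (phi_const : forall a, phi (tconst a) = c (N a))
  (phi_add : forall x y, phi (tadd x y) = phi x + phi y)
  (phi_mul : forall x y, phi (tmul x y) = phi x * phi y)
  (phi_base : forall v, phi (vbase v) = b v)
  (phi_def : forall x y, def_eq N n s x y -> phi x = phi y).

Lemma phi_tbool (B : bool) : phi (tbool N B) = B%:R.
Proof.
by rewrite phi_const; case: B; rewrite ?name1E ?name0E ?rmorph1 ?rmorph0.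
Qed.

Lemma phi_tsum m f : phi (tsum N m f) = \sum_(l < m) phi (f l).
Proof.
rewrite /tsum -[RHS](big_mkord predT (fun l => phi (f l))) /index_iota subn0.
elim: (iota 0 m) => [|l t IHt] /=.
  by rewrite big_nil phi_const name0E rmorph0.
by rewrite big_cons phi_add IHt.
Qed.

Lemma phi_vpoly e l : phi (vpoly e l) = val_poly e (CodeSeq.decode l).
Proof.
rewrite -{1}[l]CodeSeq.decodeK; elim: (CodeSeq.decode l) => [|a t IHt].
  by rewrite (phi_def (def_poly0 _ _ _ _)) phi_const.
rewrite ncode_cons.
rewrite (phi_def (def_polyS _ _ _ _ _ _)) phi_add phi_mul phi_const phi_base.
by rewrite IHt.
Qed.

Lemma phi_vword p w i j : phi (vword p w i j) = val_word p (CodeSeq.decode w) i j.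
Proof.
rewrite -{1}[w]CodeSeq.decodeK; elim: (CodeSeq.decode w) i j => [|a t IHt] i j.
  by rewrite (phi_def (def_word0 _ _ _ _ _ _)) phi_tbool.
rewrite ncode_cons /=.
case: (ltnP a s) => [lt|le].
  rewrite (phi_def (def_wordS _ _ _ _ _ _ lt)) phi_tsum; apply: eq_bigr => l _.
  by rewrite phi_mul phi_base IHt.
by rewrite (phi_def (def_word_out _ _ _ _ _ _ le)) phi_tbool.
Qed.

Lemma phi_vrel p d i j : phi (vrel p d i j) = val_rel p (CodeSeq.decode d) i j.
Proof.
rewrite /val_rel -{1}[d]CodeSeq.decodeK; elim: (CodeSeq.decode d) => [|a t IHt].
  by rewrite big_nil (phi_def (def_rel0 _ _ _ _ _ _)) phi_tbool.
rewrite ncode_cons big_cons.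
rewrite (phi_def (def_relS _ _ _ _ _ _ _ _)) phi_add phi_mul phi_const.
by rewrite phi_vword IHt.
Qed.

Lemma phi_vsum q w p i j : phi (vsum q w p i j) = val_sum q w p i j.
Proof.
rewrite /val_sum; elim: w => [|w IHw].
  by rewrite big_ord0 (phi_def (def_sum0 _ _ _ _ _ _ _)) phi_tbool.
rewrite (phi_def (def_sumS _ _ _ _ _ _ _ _)) phi_add phi_mul IHw phi_base phi_vword.
by rewrite big_ord_recr.
Qed.

Lemma phi_con ds m x y : con_eq N n s ds m x y -> phi x = value x /\ phi y = value y.
Proof.
by case=> *; rewrite phi_tbool val_tbool ?phi_vrel ?val_vrel ?phi_vsum ?val_vsum.
Qed.

End Model.

Lemma val_tsum m f : value (tsum N m f) = \sum_(l < m) value (f l).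
Proof. exact: phi_tsum val_tconst val_tadd _ _. Qed.

Lemma val_def x y : def_eq N n s x y -> value x = value y.
Proof.
case=> {x y}.
- by move=> e; rewrite val_vpoly val_tconst.
- move=> e a l; rewrite val_tadd val_tmul val_tconst val_vbase !val_vpoly.
  by rewrite decode_scons.
- by move=> p i j; rewrite val_vword val_tbool.
- move=> p a w i j lt; rewrite val_vword decode_scons /= lt val_tsum.
  by apply: eq_bigr => l _; rewrite val_tmul val_vbase val_vword.
- move=> p a w i j le; rewrite val_vword decode_scons /= val_tbool.
  by rewrite ltnNge le.
- by move=> p i j; rewrite val_vrel val_tbool /val_rel big_nil.
- move=> p t d i j; rewrite val_vrel decode_scons /val_rel big_cons.
  by rewrite val_tadd val_tmul val_tconst val_vword val_vrel.
- by move=> q p i j; rewrite val_vsum val_tbool /val_sum big_ord0.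
move=> q w p i j; rewrite val_vsum /val_sum big_ord_recr /=.
by rewrite val_tadd val_tmul val_vsum val_vbase val_vword.
Qed.

Lemma val_ring_axiom x y : ring_axiom N x y -> value x = value y.
Proof.
by case=> {x y} *; rewrite ?val_tadd ?val_tmul ?val_tadd ?val_tmul ?val_tconst
  ?name0E ?name1E ?name_addE ?name_mulE ?rmorphD ?rmorphM ?rmorph0 ?rmorph1
  ?mul1r ?mul0r ?add0r ?mulrDl //; rewrite ?addrA ?mulrA //; first [exact: addrC
  | exact: mulrC | congr (c _); apply/eqP; rewrite -name_eqE].
Qed.

Lemma val_der E x y : (forall x y, E x y -> value x = value y) ->
  der N E x y -> value x = value y.
Proof.
move=> hE; elim=> {x y} [x y|x y|x y z _ <- _ <-|x x' y y' _ e _ e'|x x' y y' _ e _ e'] //.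
- exact: hE.
- exact: val_ring_axiom.
- by rewrite !val_tadd e e'.
by rewrite !val_tmul e e'.
Qed.

Definition solution (ds m : nat) : Prop :=
  forall x y, con_eq N n s ds m x y -> value x = value y.

End Values.

Section Morphism.

Variables (A B : comNzRingType) (c : {rmorphism k -> A}) (f : {rmorphism A -> B}).
Variables (c' : {rmorphism k -> B}) (fc : forall x, f (c x) = c' x).
Variables (b : nat -> A).

Lemma rmorph_val_word p w i j : f (val_word b p w i j) = val_word (f \o b) p w i j.
Proof.
elim: w i j => [|a w IHw] i j /=; first by rewrite rmorph_nat.
case: ifP => _; last exact: rmorph0.
by rewrite rmorph_sum; apply: eq_bigr => l _; rewrite rmorphM IHw.
Qed.

Lemma rmorph_val_rel p d i j : f (val_rel c b p d i j) = val_rel c' (f \o b) p d i j.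
Proof.
rewrite /val_rel rmorph_sum; apply: eq_bigr => t _.
by rewrite rmorphM fc rmorph_val_word.
Qed.

Lemma rmorph_val_sum q w p i j : f (val_sum b q w p i j) = val_sum (f \o b) q w p i j.
Proof.
rewrite /val_sum rmorph_sum; apply: eq_bigr => t _.
by rewrite rmorphM rmorph_val_word.
Qed.

Lemma rmorph_val_con ds m x y : con_eq N n s ds m x y ->
  f (value c b x) = value c' (f \o b) x /\ f (value c b y) = value c' (f \o b) y.
Proof.
by case=> *; rewrite !val_tbool rmorph_nat ?val_vrel ?rmorph_val_rel
  ?val_vsum ?rmorph_val_sum.
Qed.

End Morphism.

(** The constraints mention finitely many entries and coefficients, with a bound independent of the
    ring. Only finitely many elements then have to be specialized, or expressed in a primitive
    element. Index 0, reserved for t, never occurs in a constraint. *)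
Lemma val_con_local ds m : exists V : nat,
  forall (A : comNzRingType) (c : {rmorphism k -> A}) (b b' : nat -> A) x y,
    (forall v, (0 < v < V)%N -> b v = b' v) -> con_eq N n s ds m x y ->
  value c b x = value c b' x /\ value c b y = value c b' y.
Proof.
pose V1 := \max_(u : 'I_m * 'I_s * 'I_n * 'I_n) ient u.1.1.1 u.1.1.2 u.1.2 u.2.
pose V2 := \max_(u : 'I_m * 'I_n * 'I_n * 'I_(word_bound n s m))
  icoef (unit_index u.1.1.1 u.1.1.2 u.1.2) u.2.
exists (maxn V1 V2).+1 => A c b b' x y hb.
have pos u v : (0 < scons u v)%N by rewrite lt0n scons_neq0.
have hent p a i j : (p < m)%N -> (a < s)%N -> (i < n)%N -> (j < n)%N ->
    b (ient p a i j) = b' (ient p a i j).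
  move=> hp ha hi hj; apply: hb; rewrite pos ltnS leq_max; apply/orP; left.
  exact: (leq_bigmax (Ordinal hp, Ordinal ha, Ordinal hi, Ordinal hj)).
have hcoef p i j u : (p < m)%N -> (i < n)%N -> (j < n)%N ->
    (u < word_bound n s m)%N ->
    b (icoef (unit_index p i j) u) = b' (icoef (unit_index p i j) u).
  move=> hp hi hj hu; apply: hb; rewrite pos ltnS leq_max; apply/orP; right.
  exact: (leq_bigmax (Ordinal hp, Ordinal hi, Ordinal hj, Ordinal hu)).
have hword p w i j : (p < m)%N -> (i < n)%N -> (j < n)%N ->
    val_word b p w i j = val_word b' p w i j.
  move=> hp; elim: w i j => //= a w IHw i j hi hj.
  by case: ifP => // ha; apply: eq_bigr => l _; rewrite IHw // hent.
case=> [t p i j ht hp hi hj|p' i' j' p i j hp' hi' hj' hp hi hj];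
  rewrite !val_tbool.
  by rewrite !val_vrel; split=> //; apply: eq_bigr => l _; rewrite hword.
by rewrite !val_vsum; split=> //; apply: eq_bigr => l _; rewrite hword // hcoef.
Qed.

End Semantics.
(** * Models of consistent equational theories *)

Section TermQuotient.

Local Open Scope quotient_scope.

Variables (k : fieldType) (N : naming k) (E : nat -> nat -> Prop).
Hypothesis consistent : ~ der N E (tbool N true) (tbool N false).

Definition der_rel : rel nat := fun x y => `[< der N E x y >].

Lemma der_rel_equiv : equiv_class_of der_rel.
Proof.
split=> [x|x y|y x z].
- by apply/asboolP; exact: der_refl.
- by apply/asboolP/asboolP; exact: der_sym.
by move=> /asboolP h1 /asboolP h2; apply/asboolP; exact: der_trans h1 h2.
Qed.

Canonical der_equiv := EquivRelPack der_rel_equiv.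

(** The proof of consistency is an argument of the type because the nontrivial ring structure
    depends on it; [field_quot] treats invertibility likewise. *)
Definition term_quot of ~ der N E (tbool N true) (tbool N false) : Type :=
  {eq_quot der_rel}.
Local Notation Q := (term_quot consistent).

HB.instance Definition _ := Choice.on Q.
HB.instance Definition _ := EqQuotient.on Q.

Definition tclass (x : nat) : Q := \pi_Q x.

Lemma tclassP x y : (tclass x = tclass y) <-> der N E x y.
Proof.
split=> [h|h]; first by apply/asboolP; have /eqmodP := h.
by apply/eqmodP; apply/asboolP.
Qed.

Lemma tclassK (x : Q) : tclass (repr x) = x.
Proof. exact: reprK. Qed.

Definition qadd (x y : Q) : Q := tclass (tadd (repr x) (repr y)).
Definition qtmul (x y : Q) : Q := tclass (tmul (repr x) (repr y)).
Definition qopp (x : Q) : Q :=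
  tclass (tmul (tconst (sval (cid (named_surj N (-1))))) (repr x)).

Lemma qaddE x y : tclass (tadd x y) = qadd (tclass x) (tclass y).
Proof. by apply/tclassP; apply: der_add; apply/tclassP; rewrite tclassK. Qed.

Lemma qmulE x y : tclass (tmul x y) = qtmul (tclass x) (tclass y).
Proof. by apply/tclassP; apply: der_mul; apply/tclassP; rewrite tclassK. Qed.

Lemma qaddA : associative qadd.
Proof.
move=> x y z; rewrite -[x]tclassK -[y]tclassK -[z]tclassK -!qaddE.
by apply/tclassP/der_ring; exact: ax_addA.
Qed.

Lemma qaddC : commutative qadd.
Proof.
move=> x y; rewrite -[x]tclassK -[y]tclassK -!qaddE.
by apply/tclassP/der_ring; exact: ax_addC.
Qed.

Lemma qadd0 : left_id (tclass (tbool N false)) qadd.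
Proof.
move=> x; rewrite -[x]tclassK -!qaddE.
by apply/tclassP/der_ring; exact: ax_add0.
Qed.

Lemma tclass_name_eq a b : N a = N b -> tclass (tconst a) = tclass (tconst b).
Proof.
by move=> e; apply/tclassP/der_ring; apply: ax_const; rewrite name_eqE e.
Qed.

Lemma tclass_constD a b :
  tclass (tconst (name_add N a b)) = qadd (tclass (tconst a)) (tclass (tconst b)).
Proof. by rewrite -qaddE; apply/esym/tclassP/der_ring; exact: ax_constD. Qed.

Lemma tclass_constM a b :
  tclass (tconst (name_mul N a b)) = qtmul (tclass (tconst a)) (tclass (tconst b)).
Proof. by rewrite -qmulE; apply/esym/tclassP/der_ring; exact: ax_constM. Qed.

Lemma qtmulA : associative qtmul.
Proof.
move=> x y z; rewrite -[x]tclassK -[y]tclassK -[z]tclassK -!qmulE.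
by apply/tclassP/der_ring; exact: ax_mulA.
Qed.

Lemma qtmulC : commutative qtmul.
Proof.
move=> x y; rewrite -[x]tclassK -[y]tclassK -!qmulE.
by apply/tclassP/der_ring; exact: ax_mulC.
Qed.

Lemma qtmul1 : left_id (tclass (tbool N true)) qtmul.
Proof.
move=> x; rewrite -[x]tclassK -!qmulE.
by apply/tclassP/der_ring; exact: ax_mul1.
Qed.

Lemma qtmulDl : left_distributive qtmul qadd.
Proof.
move=> x y z; rewrite -[x]tclassK -[y]tclassK -[z]tclassK -!(qaddE, qmulE).
by apply/tclassP/der_ring; exact: ax_mulDl.
Qed.

Lemma qaddN : left_inverse (tclass (tbool N false)) qopp qadd.
Proof.
move=> x; rewrite /qopp; case: cid => a /= ha; rewrite qmulE tclassK.
rewrite -{2}[x]qtmul1 -qtmulDl -tclass_constD (@tclass_name_eq _ (name0 N)); last first.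
  by rewrite name_addE ha name1E name0E addNr.
rewrite -[x]tclassK -qmulE; apply/tclassP/der_ring; exact: ax_mul0.
Qed.

Lemma tclass1_neq0 : tclass (tbool N true) != tclass (tbool N false).
Proof. by apply/eqP => /tclassP. Qed.

HB.instance Definition _ := GRing.isZmodule.Build Q qaddA qaddC qadd0 qaddN.
HB.instance Definition _ := GRing.Zmodule_isComNzRing.Build Q
  qtmulA qtmulC qtmul1 qtmulDl tclass1_neq0.

Lemma tclassD x y : tclass (tadd x y) = tclass x + tclass y.
Proof. exact: qaddE. Qed.

Lemma tclassM x y : tclass (tmul x y) = tclass x * tclass y.
Proof. exact: qmulE. Qed.

Definition tclass_const (x : k) : Q := tclass (tconst (sval (cid (named_surj N x)))).

Lemma tclass_constE a : tclass (tconst a) = tclass_const (N a).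
Proof. by rewrite /tclass_const; case: cid => b /= e; apply: tclass_name_eq. Qed.

Lemma tclass_const_add x y : tclass_const (x + y) = tclass_const x + tclass_const y.
Proof.
have [a <-] := named_surj N x; have [b <-] := named_surj N y.
by rewrite -name_addE -!tclass_constE tclass_constD.
Qed.

Lemma tclass_const_zmod : zmod_morphism tclass_const.
Proof. by move=> x y; apply: (addIr (tclass_const y)); rewrite -tclass_const_add !subrK. Qed.

Lemma tclass_const_monoid : monoid_morphism tclass_const.
Proof.
split=> [|x y]; first by rewrite -(name1E N) -tclass_constE.
have [a <-] := named_surj N x; have [b <-] := named_surj N y.
by rewrite -name_mulE -!tclass_constE tclass_constM.
Qed.

HB.instance Definition _ := GRing.isZmodMorphism.Build k Q tclass_const
  tclass_const_zmod.
HB.instance Definition _ := GRing.isMonoidMorphism.Build k Q tclass_const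
  tclass_const_monoid.

End TermQuotient.

Section FieldQuotient.

Variables (k : fieldType) (N : naming k) (E : nat -> nat -> Prop).
Hypothesis consistent : ~ der N E (tbool N true) (tbool N false).
Hypothesis invertible : forall x, ~ der N E x (tbool N false) ->
  exists u, der N E (tmul u x) (tbool N true).

Definition field_quot of (forall x, ~ der N E x (tbool N false) ->
  exists u, der N E (tmul u x) (tbool N true)) : Type := term_quot consistent.
Local Notation K := (field_quot invertible).

HB.instance Definition _ := GRing.ComNzRing.on K.

Lemma field_quot_inv (x : K) : exists y : K, x != 0 -> y * x = 1.
Proof.
have [x0|/negP x0] := boolP (x != 0); last by exists 0.
have [|u hu] := @invertible (repr (x : term_quot consistent)).
  move=> /(tclassP consistent); rewrite tclassK => e.
  by move/eqP: x0; rewrite e.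
exists (tclass consistent u) => _.
have /(tclassP consistent) := hu; rewrite tclassM tclassK; exact.
Qed.

Definition field_quot_invr (x : K) : K :=
  if x == 0 then 0 else sval (cid (field_quot_inv x)).

Lemma field_quot_mulVf x : x != 0 -> field_quot_invr x * x = 1.
Proof.
rewrite /field_quot_invr; case: cid => y /= hy x0.
by rewrite (negPf x0) hy.
Qed.

Lemma field_quot_invr0 : field_quot_invr 0 = 0.
Proof. by rewrite /field_quot_invr; case: cid => y /= _; rewrite eqxx. Qed.

HB.instance Definition _ := GRing.ComNzRing_isField.Build K
  field_quot_mulVf field_quot_invr0.

End FieldQuotient.

(** * Maximal consistent theories *)

Section MaximalTheory.

Variables (k : fieldType) (N : naming k).

(** Adding the hypothesis that a is 0 amounts to passing to the quotient of the term ring by the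
    ideal generated by a. *)
Lemma der_add_zero E a x y : ~ der N E (tbool N true) (tbool N false) ->
    der N (fun u v => E u v \/ u = a /\ v = tbool N false) x y ->
  exists u, der N E x (tadd y (tmul u a)).
Proof.
move=> cons h; pose cl := tclass cons.
suff [u hu] : exists u, cl x = cl y + u * cl a.
  exists (repr u); apply/(tclassP cons).
  by rewrite tclassD tclassM tclassK.
elim: h => {x y} [x y [h|[-> ->]]|x y h|x y z _ [u hu] _ [v hv]|
    x x' y y' _ [u hu] _ [v hv]|x x' y y' _ [u hu] _ [v hv]].
- by exists 0; rewrite mul0r addr0; apply/tclassP; exact: der_hyp.
- by exists 1; rewrite mul1r [X in X + _](_ : _ = 0) ?add0r.
- by exists 0; rewrite mul0r addr0; apply/tclassP; exact: der_ring.
- by exists (v - u); rewrite mulrBl addrA -hv hu addrK.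
- by exists (u + v); rewrite /cl !tclassD -/cl hu hv mulrDl addrACA.
(* The cofactor of a in (x' + u a)(y' + v a) - x' y'. *)
exists (u * cl y' + cl x' * v + u * v * cl a).
rewrite /cl !tclassM -/cl hu hv.
move: (cl x') (cl y') (cl a) u v {hu hv}; move: (term_quot cons : comNzRingType).
by move=> R X Y A u v; ring.
Qed.

(** Compactness: a derivation uses finitely many hypotheses, and of two members of the chain one
    contains the other. The first alternative covers derivations that use no member of F, in
    particular an empty F. *)
Lemma der_chain (F : set (set (nat * nat))) E x y : total_on F subset ->
    der N (fun u v => E u v \/ (\bigcup_(X in F) X)%classic (u, v)) x y ->
  der N E x y \/ exists2 X, F X & der N (fun u v => E u v \/ X (u, v)) x y.
Proof.
move=> totF; pose D X u v := E u v \/ X (u, v).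
pose G x y := der N E x y \/ exists2 X, F X & der N (D X) x y.
have sub0 X u v : der N E u v -> der N (D X) u v.
  by apply: der_sub => ? ? ?; apply: der_hyp; left.
have sub X Y u v : (X `<=` Y)%classic -> der N (D X) u v -> der N (D Y) u v.
  by move=> h; apply: der_sub => ? ? [?|/h ?]; apply: der_hyp; [left | right].
have two u v u' v' : G u v -> G u' v' -> (der N E u v /\ der N E u' v') \/
    exists2 X, F X & der N (D X) u v /\ der N (D X) u' v'.
  move=> [h|[X FX h]] [h'|[Y FY h']]; first by left.
  - by right; exists Y => //; split=> //; exact: sub0.
  - by right; exists X => //; split=> //; exact: sub0.
  right; have [XY|YX] := totF _ _ FX FY.
    by exists Y => //; split=> //; exact: sub h.
  by exists X => //; split=> //; exact: sub h'.
elim=> {x y} [x y [h|[X FX h]]|x y h|x y z _ h1 _ h2|x x' y y' _ h1 _ h2|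
    x x' y y' _ h1 _ h2].
- by left; exact: der_hyp.
- by right; exists X => //; apply: der_hyp; right.
- by left; exact: der_ring.
- have [[a b]|[X FX [a b]]] := two _ _ _ _ h1 h2; [left|right; exists X => //];
  exact: der_eucl a b.
- have [[a b]|[X FX [a b]]] := two _ _ _ _ h1 h2; [left|right; exists X => //];
  exact: der_add.
have [[a b]|[X FX [a b]]] := two _ _ _ _ h1 h2; [left|right; exists X => //];
exact: der_mul.
Qed.

(** The argument for maximal ideals, in terms of theories: if x is not derivably 0 in a maximal
    consistent theory, then adding x = 0 makes 1 = 0 derivable, and [der_add_zero] turns this into 1
    = 0 + u x. *)
Lemma maximal_theory E : ~ der N E (tbool N true) (tbool N false) ->
  exists E' : nat -> nat -> Prop, [/\ forall x y, E x y -> E' x y,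
    ~ der N E' (tbool N true) (tbool N false) &
    forall x, ~ der N E' x (tbool N false) ->
      exists u, der N E' (tmul u x) (tbool N true)].
Proof.
move=> cons; pose D X u v := E u v \/ X (u, v).
pose P : set (set (nat * nat)) :=
  fun X => ~ der N (D X) (tbool N true) (tbool N false).
have [F FP totF|Z [PZ maxZ]] := @Zorn_bigcup _ P.
  move=> /(der_chain totF)[/cons //|[X FX]].
  exact: (FP _ FX).
exists (D Z); split=> [x y h|//|x hx]; first by left.
have : ~ P (Z `|` [set (x, tbool N false)])%classic.
  apply: maxZ; split; first by move=> ? ?; left.
  move=> h; apply: hx; apply: der_hyp; right; apply: h; right; exact: erefl.
move=> /contrapT h.
have [|u hu] := @der_add_zero (D Z) x (tbool N true) (tbool N false) PZ.
  apply: der_sub h => u v [?|[?|[-> ->]]]; apply: der_hyp.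
  - by left; left.
  - by left; right.
  by right.
exists u; apply: der_sym; apply: der_trans hu _.
by apply: der_ring; exact: ax_add0.
Qed.

End MaximalTheory.
Section PolyEval.

Variables (R A : comNzRingType) (c : {rmorphism R -> A}) (x : A).

Definition poly_eval (f : {poly R}) : A := (map_poly c f).[x].

Lemma poly_eval_zmod : zmod_morphism poly_eval.
Proof. by move=> f g; rewrite /poly_eval rmorphB hornerD hornerN. Qed.

Lemma poly_eval_monoid : monoid_morphism poly_eval.
Proof.
by split=> [|f g]; rewrite /poly_eval ?rmorph1 ?hornerC // rmorphM hornerM.
Qed.

HB.instance Definition _ := GRing.isZmodMorphism.Build {poly R} A poly_eval
  poly_eval_zmod.
HB.instance Definition _ := GRing.isMonoidMorphism.Build {poly R} A poly_eval
  poly_eval_monoid.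

Lemma poly_evalC a : poly_eval a%:P = c a.
Proof. by rewrite /poly_eval map_polyC hornerC. Qed.

Lemma poly_evalX : poly_eval 'X = x.
Proof. by rewrite /poly_eval map_polyX hornerX. Qed.

Lemma poly_evalZ a f : poly_eval (a *: f) = c a * poly_eval f.
Proof. by rewrite -mul_polyC rmorphM /= poly_evalC. Qed.

Lemma poly_eval_eq0 f : map_poly c f = 0 -> poly_eval f = 0.
Proof. by rewrite /poly_eval => ->; rewrite horner0. Qed.

End PolyEval.

(** * Specialization of points to an algebraically closed field *)

Lemma pseudo_division (R : idomainType) (f q : {poly R}) : q != 0 ->
  exists a s r, [/\ a != 0, a *: f = s * q + r, (size r < size q)%N &
    exists e, a = lead_coef q ^+ e].
Proof.
move=> q0; exists (lead_coef q ^+ scalp f q), (f %/ q)%R, (f %% q)%R.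
split; last by exists (scalp f q).
- by rewrite expf_neq0 // lead_coef_eq0.
- exact: Pdiv.Idomain.divp_eq.
by rewrite Pdiv.Idomain.ltn_modp.
Qed.

Section Specialization.

Variables (K : fieldType) (F : closedFieldType).

Section OneVariable.

Variables (R : idomainType) (j : {rmorphism R -> K}) (x : K).

Local Notation "f ^j" := (map_poly j f) (at level 2, format "f ^j").
Local Notation ev := (poly_eval j x).

(** The homomorphism j may have a kernel: in [specialize] it evaluates a polynomial ring at a point.
    Leading coefficients may thus be lost under j, and truncation discards the top terms that j
    kills. *)
Lemma trunc_poly (f : {poly R}) :
  exists2 f' : {poly R}, f'^j = f^j & size f' = size f^j.
Proof.
have e : (take_poly (size f^j) f)^j = f^j.
  apply/polyP => i; rewrite !coef_map coef_take_poly /=.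
  case: ltnP => // le; rewrite rmorph0 -[RHS](coef_map j).
  by rewrite nth_default.
exists (take_poly (size f^j) f) => //; apply/eqP.
by rewrite eqn_leq size_take_poly /= -{1}e size_poly.
Qed.

Lemma lead_coef_trunc (f : {poly R}) : size f = size f^j -> f^j != 0 ->
  j (lead_coef f) != 0.
Proof. by move=> e f0; rewrite lead_coefE e -(coef_map j) -lead_coefE lead_coef_eq0. Qed.

Lemma trunc_neq0 (f : {poly R}) : size f = size f^j -> f^j != 0 -> f != 0.
Proof. by move=> e; rewrite -!size_poly_eq0 e. Qed.

(* The minimality of q makes it irreducible over the fractions of the image of R. *)
Lemma unit_modulo_minimal (g q : {poly R}) :
    ev g != 0 -> ev q = 0 -> q^j != 0 -> size q = size q^j ->
    (forall f, ev f = 0 -> (size f^j < size q^j)%N -> f^j = 0) ->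
  exists (u : {poly R}) (h : R), j h != 0 /\ ev (u * g) = j h.
Proof.
move=> gx qx q0 sq qmin.
have lq := lead_coef_trunc sq q0; have q0' := trunc_neq0 sq q0.
(* Descent in the style of Euclid: e agrees at x with a multiple of g and does not vanish there, and
   its size decreases until it is a constant, which is h. *)
suff main m (e u : {poly R}) : (size e < m)%N -> ev e != 0 -> ev (u * g) = ev e ->
    exists (u : {poly R}) (h : R), j h != 0 /\ ev (u * g) = j h.
  by apply: (main (size g).+1 g 1) => //; rewrite mul1r.
elim: m e u => // m IHm e0 u; rewrite ltnS => le0 e0x ue0.
have [e ee se] := trunc_poly e0.
have ex : ev e = ev e0 by rewrite /poly_eval ee.
have {}se : size e = size e^j by rewrite ee.
have le : (size e <= m)%N by rewrite (leq_trans _ le0) // se ee size_poly.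
rewrite -ex in e0x ue0 => {ex le0 ee e0}.
have ej0 : e^j != 0 by apply: contraNneq e0x => /(poly_eval_eq0 x) ->.
have el := lead_coef_trunc se ej0; have e0 := trunc_neq0 se ej0.
have [le1|gt1] := leqP (size e) 1.
  have ec := size1_polyC le1; rewrite ec poly_evalC in e0x ue0.
  by exists u, e`_0.
have [lt|ge] := ltnP (size e) (size q).
  have [a [s [r [a0 eq lr [N ea]]]]] := pseudo_division q e0.
  have rx : ev r = - (ev s * ev e).
    move/(f_equal ev): eq; rewrite poly_evalZ qx mulr0 rmorphD rmorphM /= => /eqP.
    by rewrite eq_sym addrC addr_eq0 => /eqP.
  have [rx0|rx0] := eqVneq (ev r) 0; last first.
    apply: (IHm r (- (s * u))) => //; first exact: leq_trans lr le.
    by rewrite mulNr -mulrA rmorphN rmorphM /= ue0 rx.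
  (* A remainder vanishing at x would make the quotient s vanish at x; as e is not constant, s is
     shorter than q, against the minimality of q. *)
  have sx : ev s = 0.
    by move: rx; rewrite rx0 => /esym/eqP; rewrite oppr_eq0 mulf_eq0 (negPf e0x) orbF => /eqP.
  have rj : r^j = 0.
    apply: qmin => //; apply: leq_ltn_trans (size_poly _ _) _; rewrite -sq.
    exact: ltn_trans lr lt.
  have ja : j a != 0 by rewrite ea rmorphXn expf_neq0.
  have qj : j a *: q^j = s^j * e^j by rewrite -map_polyZ eq rmorphD rmorphM /= rj addr0.
  have sj0 : s^j != 0.
    apply: contraNneq q0 => sj0; move: qj; rewrite sj0 mul0r => /eqP.
    by rewrite scaler_eq0 (negPf ja).
  case/eqP: (sj0); apply: qmin => //.
  have -> : size q^j = (size s^j + size e).-1.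
    transitivity (size (s^j * e^j)); first by rewrite -qj size_scale.
    by rewrite size_mul // se.
  by move: (size s^j) gt1 => /=; lia.
have [a [s [r [a0 eq lr [N ea]]]]] := pseudo_division e q0'.
have rx : ev r = j a * ev e.
  by rewrite -poly_evalZ eq rmorphD rmorphM /= qx mulr0 add0r.
have ja : j a != 0 by rewrite ea rmorphXn expf_neq0.
apply: (IHm r (a *: u)).
- by apply: leq_trans le; apply: leq_trans ge.
- by rewrite rx mulf_neq0.
by rewrite -scalerAl poly_evalZ ue0 rx.
Qed.

(* If x is transcendental over the image of R, then h is a coefficient of g;
   otherwise h is the product of the leading coefficient of a polynomial q of
   minimal degree killing x and of a multiple of g in R modulo q. *)
Lemma specialize_one (g : {poly R}) : ev g != 0 ->
  exists2 h : R, j h != 0 &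
  forall th : {rmorphism R -> F}, (forall a, j a = 0 -> th a = 0) -> th h != 0 ->
  exists2 y : F, poly_eval th y g != 0 &
    forall f : {poly R}, ev f = 0 -> poly_eval th y f = 0.
Proof.
move=> gx; have ker (th : {rmorphism R -> F}) : (forall a, j a = 0 -> th a = 0) ->
    forall f : {poly R}, f^j = 0 -> map_poly th f = 0.
  move=> hth f f0; apply/polyP => i; rewrite coef_map coef0 /=; apply: hth.
  by rewrite -(coef_map j) f0 coef0.
have g0 : g^j != 0 by apply: contraNneq gx => /(poly_eval_eq0 x) ->.
have [halg|htr] := pselect (exists m, exists q : {poly R},
    [/\ ev q = 0, q^j != 0 & size q^j = m]); last first.
  have [g' eg sg] := trunc_poly g; have sg' : size g' = size g'^j by rewrite eg.
  exists (lead_coef g'); first by apply: lead_coef_trunc; rewrite ?eg.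
  move=> th hth hl.
  have eth : map_poly th g = map_poly th g'.
    have : map_poly th (g - g') = 0 by apply: ker; rewrite // rmorphB /= eg subrr.
    by rewrite rmorphB => /eqP; rewrite subr_eq0 => /eqP.
  have thg : map_poly th g != 0.
    apply: contraNneq hl => e; rewrite lead_coefE -(coef_map th) -eth e.
    by rewrite coef0.
  have [y hy] := closed_nonrootP _ thg; exists y; first exact: hy.
  move=> f fx; apply/poly_eval_eq0/ker => //.
  have [//|f0] := eqVneq f^j 0; case: htr.
  by exists (size f^j), f.
have halg' : exists m, `[< exists q : {poly R},
    [/\ ev q = 0, q^j != 0 & size q^j = m] >].
  by case: halg => m h; exists m; apply/asboolP.
case: (ex_minnP halg') => m /asboolP[q0 [q0x q0j q0s]] mmin.
have [q eq sq] := trunc_poly q0.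
have qx : ev q = 0 by rewrite -q0x /poly_eval eq.
have qj : q^j != 0 by rewrite eq.
have {}sq : size q = size q^j by rewrite eq.
have qmin f : ev f = 0 -> (size f^j < size q^j)%N -> f^j = 0.
  move=> fx lt; apply/eqP/negPn/negP => f0.
  have : (m <= size f^j)%N by apply: mmin; apply/asboolP; exists f.
  by rewrite leqNgt -q0s -eq lt.
have [u [h [jh uh]]] := unit_modulo_minimal gx qx qj sq qmin.
have lq := lead_coef_trunc sq qj; have q0' := trunc_neq0 sq qj.
exists (lead_coef q * h); first by rewrite rmorphM mulf_neq0.
move=> th hth; rewrite rmorphM mulf_eq0 negb_or => /andP[tl thh].
have sthq : size (map_poly th q) = size q by rewrite size_map_poly_id0.
have [y hy] : exists y, root (map_poly th q) y.
  apply/closed_rootP; rewrite sthq; apply: contraTneq lq => s1.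
  have /eqP := s1; rewrite eqn_leq => /andP[/size1_polyC ec _].
  move: qx; rewrite ec poly_evalC lead_coefC => ->.
  by rewrite eqxx.
(* Up to a power of the leading coefficient of q, f is a multiple of q plus a remainder that j kills
   by minimality, so that th kills it too; the leading coefficient survives under th. *)
have zero f : ev f = 0 -> poly_eval th y f = 0.
  move=> fx; have [a [s [r [a0 e lr [N ea]]]]] := pseudo_division f q0'.
  have rx : ev r = 0.
    have := f_equal ev e; rewrite poly_evalZ fx mulr0 rmorphD rmorphM /= qx.
    by rewrite mulr0 add0r => <-.
  have /(ker _ hth)/(poly_eval_eq0 y) tr : r^j = 0.
    apply: qmin => //; apply: leq_ltn_trans (size_poly _ _) _; by rewrite -sq.
  have := f_equal (poly_eval th y) e.
  rewrite poly_evalZ rmorphD rmorphM /= tr addr0.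
  have -> : poly_eval th y q = 0 by apply/eqP.
  move/eqP; rewrite mulr0 mulf_eq0 => /orP[|/eqP //].
  by rewrite ea rmorphXn expf_eq0 (negPf tl) andbF.
exists y => //.
have : poly_eval th y (u * g - h%:P) = 0.
  by apply: zero; rewrite rmorphB /= uh poly_evalC subrr.
rewrite rmorphB rmorphM /= poly_evalC => /eqP; rewrite subr_eq0 => /eqP e.
by apply: contraNneq thh => g0'; rewrite -e g0' mulr0.
Qed.

End OneVariable.

(** Induction over the points for all R at once: adjoining x replaces R by [{poly R}], and the
    element that must survive over [{poly R}] is the polynomial to which [specialize_one] is
    applied. Only the compatibility of kernels is carried along, so R' need not embed in K. *)
Lemma specialize (xs : seq K) : forall (R : idomainType) (j : {rmorphism R -> K}),
  exists2 h : R, j h != 0 &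
  forall th : {rmorphism R -> F}, (forall a, j a = 0 -> th a = 0) -> th h != 0 ->
  exists (R' : idomainType) (i : {rmorphism R -> R'}) (j' : {rmorphism R' -> K})
    (th' : {rmorphism R' -> F}) (xi : nat -> R'),
  [/\ forall a, j' (i a) = j a, forall a, th' (i a) = th a,
      forall a, j' a = 0 -> th' a = 0 & forall v, j' (xi v) = nth 0 xs v].
Proof.
elim: xs => [|x xs IHxs] R j.
  exists 1; first by rewrite rmorph1 oner_neq0.
  move=> th hth _; exists R, idfun, j, th, (fun _ => 0).
  by split=> // v; rewrite nth_nil rmorph0.
have [h' jh' H'] := IHxs {poly R} (poly_eval j x).
have [h jh H] := specialize_one jh'; exists h => // th hth thh.
have [y hy zero] := H th hth thh.
have [R' [i [j' [th' [xi [e1 e2 e3 e4]]]]]] := H' (poly_eval th y) zero hy.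
exists R', (i \o polyC), j', th', (fun v => if v is v'.+1 then xi v' else i 'X).
split=> [a|a|//|[|v]] /=.
- exact: etrans (e1 _) (poly_evalC _ _ _).
- exact: etrans (e2 _) (poly_evalC _ _ _).
- exact: etrans (e1 _) (poly_evalX _ _).
exact: e4.
Qed.

End Specialization.
(** * Solvability of the systems *)

Section Models.

Variables (k : fieldType) (N : naming k) (E : nat -> nat -> Prop).
Hypothesis consistent : ~ der N E (tbool N true) (tbool N false).

Lemma ring_model : exists (A : comNzRingType) (c : {rmorphism k -> A}) (phi : nat -> A),
  [/\ forall a, phi (tconst a) = c (N a),
      forall x y, phi (tadd x y) = phi x + phi y,
      forall x y, phi (tmul x y) = phi x * phi y &
      forall x y, phi x = phi y <-> der N E x y].
Proof.
exists (term_quot consistent), (tclass_const consistent), (tclass consistent).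
by split; [exact: tclass_constE | exact: tclassD | exact: tclassM | exact: tclassP].
Qed.

Lemma field_model : exists (K : fieldType) (c : {rmorphism k -> K}) (phi : nat -> K),
  [/\ forall a, phi (tconst a) = c (N a),
      forall x y, phi (tadd x y) = phi x + phi y,
      forall x y, phi (tmul x y) = phi x * phi y &
      forall x y, E x y -> phi x = phi y].
Proof.
have [E' [sub cons inv]] := maximal_theory consistent.
exists (@field_quot _ _ _ cons inv), (tclass_const cons), (tclass cons).
split; [exact: tclass_constE | exact: tclassD | exact: tclassM |].
by move=> x y /sub h; apply/(tclassP cons)/der_hyp.
Qed.

End Models.

Lemma poly_eval_val_poly (k : fieldType) (N : naming k) (A : comNzRingType)
    (c : {rmorphism k -> A}) (b : nat -> A) e l :
  poly_eval c (b 0) (val_poly N polyC (fun _ => 'X) e l) = val_poly N c b e l.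
Proof.
elim: l => [|a l IHl] /=; first by rewrite poly_evalC.
by rewrite rmorphD rmorphM /= poly_evalC poly_evalX IHl.
Qed.

Section Solvability.

Variables (k : fieldType) (N : naming k) (n s ds m : nat).
Variables (F : closedFieldType) (iota : {rmorphism k -> F}).

Lemma refutable_unsolvable b : refutable N n s ds m -> ~ solution N n s iota b ds m.
Proof.
move=> href sol; have : value N n s iota b (tbool N true) = value N n s iota b (tbool N false).
  apply: val_der href => x y []; [exact: val_def | exact: sol].
by rewrite !val_tbool => /eqP; rewrite oner_eq0.
Qed.

(* The Nullstellensatz for these systems. *)
Lemma unsolvable_refutable : (forall b, ~ solution N n s iota b ds m) ->
  refutable N n s ds m.
Proof.
move=> nosol; apply: contrapT => cons.
have [K [c [phi [hc hD hM hE]]]] := field_model cons.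
have [V hV] := val_con_local N n s ds m.
pose xs := mkseq (fun v => phi (vbase v)) V.
have [h ch /(_ iota)] := specialize F xs c.
have h0 : h != 0 by apply: contraNneq ch => ->; rewrite rmorph0.
(* Both conditions on the starting homomorphism hold because homomorphisms out of the field k are
   injective. *)
case=> [a /eqP||R' [i [j [th [xi [e1 e2 e3 e4]]]]]].
- by rewrite fmorph_eq0 => /eqP ->; rewrite rmorph0.
- by rewrite fmorph_eq0.
apply: (nosol (th \o xi)) => x y hxy.
have [vx vy] := rmorph_val_con (f := j) e1 xi hxy.
have [tx ty] := rmorph_val_con (f := th) e2 xi hxy.
have hphi : forall x y, def_eq N n s x y -> phi x = phi y.
  by move=> u v huv; apply: hE; left.
have [px py] := phi_con (b := fun v => phi (vbase v)) hc hD hM (fun _ => erefl) hphi hxy.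
have [lx ly] : value N n s c (fun v => phi (vbase v)) x = value N n s c (j \o xi) x /\
    value N n s c (fun v => phi (vbase v)) y = value N n s c (j \o xi) y.
  by apply: hV hxy => v /andP[_ lt]; rewrite /= e4 nth_mkseq.
(* The model satisfies the constraint, so j kills the difference of the two sides, and hence th
   does. *)
have jxy : j (value N n s i xi x - value N n s i xi y) = 0.
  by rewrite rmorphB /= vx vy -lx -ly -px -py (hE x y) ?subrr //; right.
by have /eqP := e3 _ jxy; rewrite rmorphB /= tx ty subr_eq0 => /eqP.
Qed.

Lemma size_val_poly (a : nat) l : a = name1 N ->
  size (val_poly N polyC (fun _ => 'X) a l) = (size l).+1 :> nat /\
  val_poly N polyC (fun _ => 'X) a l \is @monic k.
Proof.
move=> ->; elim: l => [|u l [IHs IHm]] /=; first by rewrite name1E size_poly1 monic1.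
have q0 : val_poly N polyC (fun _ => 'X) (name1 N) l != 0.
  by rewrite -size_poly_eq0 IHs.
rewrite addrC mulrC size_MXaddC (negPf q0) /= IHs; split=> //.
by rewrite monicE lead_coefDl ?lead_coefMX -?monicE // size_mulX // IHs size_polyC;
  case: (_ != 0).
Qed.

Lemma certified_solvable : certified N n s ds m -> exists b, solution N n s iota b ds m.
Proof.
move=> [r [h [r0 H]]].
pose p := val_poly N polyC (fun _ => 'X) (name1 N) (CodeSeq.decode r).
have [z pz] : exists z, poly_eval iota z p = 0.
  have [sp pm] := size_val_poly (CodeSeq.decode r) (erefl (name1 N)).
  have /closed_rootP[z /eqP hz] : size (map_poly iota p) != 1%N.
    rewrite size_map_poly /p sp eqSS size_eq0; apply: contraNneq r0 => e.
    by rewrite -[r]CodeSeq.decodeK e.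
  by exists z.
pose b v := if v is v'.+1
  then val_poly N iota (fun _ => z) (name0 N) (CodeSeq.decode (snth h v)) else z.
exists b => x y hxy; apply: val_der (H _ _ hxy) => {x y hxy} x y.
move=> [|[[-> ->]|[v [-> ->]]]]; first exact: val_def.
  rewrite val_vpoly val_tbool; apply: etrans pz.
  exact/esym/(poly_eval_val_poly N iota b).
by rewrite val_vbase val_vpoly.
Qed.

End Solvability.

(** * Certificates from a primitive element *)

Section PrimitiveElement.

Variables (k : fieldType) (char0 : [pchar k] =i pred0).
Variables (F : closedFieldType) (iota : {rmorphism k -> F}).
Hypothesis algebraic : is_alg_closure iota.

Lemma algebraic_root x : exists2 p : {poly k}, p != 0 & root (map_poly iota p) x.
Proof. by have [p pm px] := algebraic x; exists p => //; exact: monic_neq0. Qed.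

Lemma primitive_element (xs : seq F) : exists z, forall x, x \in xs ->
  exists p, poly_eval iota z p = x.
Proof.
elim: xs => [|x xs [z hz]]; first by exists 0.
have [p p0 px] := algebraic_root x; have [q q0 qz] := algebraic_root z.
have [e [[u hu] [v hv]]] := pchar0_PET p0 px q0 qz char0.
exists (z *+ e - x) => y; rewrite inE => /orP[/eqP ->|/hz[w <-]]; first by exists u.
exists (w \Po v); rewrite /poly_eval map_comp_poly horner_comp hv.
by [].
Qed.

Lemma minimal_polynomial z : exists p : {poly k}, [/\ p \is monic, (1 < size p)%N,
  poly_eval iota z p = 0 & forall q, poly_eval iota z q = 0 -> exists u, q = u * p].
Proof.
have [p0 p00 p0z] := algebraic_root z.
pose P d := `[< exists p : {poly k}, [/\ p != 0, poly_eval iota z p = 0 & size p = d] >].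
have exP : exists d, P d.
  by exists (size p0); apply/asboolP; exists p0; split=> //; apply/eqP.
case: (ex_minnP exP) => d /asboolP[p [p_n0 pz sp]] dmin.
have l0 : lead_coef p != 0 by rewrite lead_coef_eq0.
have l0' : (lead_coef p)^-1 != 0 by rewrite invr_eq0.
exists ((lead_coef p)^-1 *: p); split.
- by rewrite monicE lead_coefZ mulVf.
- rewrite size_scale // ltnNge; apply: contraTN isT => /size1_polyC ep.
  by move: pz p_n0; rewrite ep poly_evalC polyC_eq0 => /eqP; rewrite fmorph_eq0 => ->.
- by rewrite poly_evalZ pz mulr0.
move=> q qz; exists ((q %/ p) * (lead_coef p)%:P).
rewrite -mulrA mul_polyC scalerA divff // scale1r.
rewrite {1}(divp_eq q p).
suff -> : q %% p = 0 by rewrite addr0.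
apply/eqP/negPn/negP => r0.
have rz : poly_eval iota z (q %% p) = 0.
  by move: qz; rewrite {1}(divp_eq q p) rmorphD rmorphM /= pz mulr0 add0r.
have : (d <= size (q %% p)%R)%N by apply: dmin; apply/asboolP; exists (q %% p).
by rewrite leqNgt -sp ltn_modp p_n0.
Qed.

Lemma name_poly (N : naming k) (q : {poly k}) :
  exists l, val_poly N polyC (fun _ => 'X) (name0 N) l = q.
Proof.
elim/poly_ind: q => [|q c [l hl]]; first by exists [::]; rewrite /= name0E.
have [a ha] := named_surj N c.
by exists (a :: l); rewrite /= hl ha addrC mulrC.
Qed.

Lemma name_monic_poly (N : naming k) (q : {poly k}) : q \is monic ->
  exists l, val_poly N polyC (fun _ => 'X) (name1 N) l = q.
Proof.
elim/poly_ind: q => [|q c IHq]; first by rewrite monicE lead_coef0 eq_sym oner_eq0.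
have [->|q0] := eqVneq q 0.
  rewrite mul0r add0r monicE lead_coefC => /eqP ->.
  by exists [::]; rewrite /= name1E.
rewrite monicE lead_coefDl; last first.
  rewrite size_mulX // size_polyC ltnS; apply: leq_trans (leq_b1 _) _.
  by rewrite size_poly_gt0.
rewrite lead_coefMX -monicE => /IHq[l hl]; have [a ha] := named_surj N c.
by exists (a :: l); rewrite /= hl ha addrC mulrC.
Qed.

(** Read in k[t], the two sides of a constraint agree at the primitive element z, so they differ by
    a multiple of its minimal polynomial p. In the term ring of [lower_eq] p vanishes at t, so the
    two sides become equal there, and equality in that ring is derivability. *)
Lemma solvable_certified (N : naming k) n s ds m b :
  solution N n s iota b ds m -> certified N n s ds m.
Proof.
move=> sol; have [V hV] := val_con_local N n s ds m.
have [z hz] := primitive_element (mkseq b V).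
have [p [pm p1 pz pdvd]] := minimal_polynomial z.
have /choice[l hl] v : exists l, (v < V)%N ->
    poly_eval iota z (val_poly N polyC (fun _ => 'X) (name0 N) l) = b v.
  have [lt|] := boolP (v < V)%N; last by exists [::].
  have [q hq] : exists q, poly_eval iota z q = b v.
    by apply: hz; rewrite map_f // mem_iota.
  by have [l hl] := name_poly N q; exists l; rewrite hl.
have [r hr] := name_monic_poly N pm.
pose h := ncode (mkseq (fun v => ncode (l v)) V).
exists (ncode r), h; split.
  apply: contraTneq p1 => e; have er : r = [::] by rewrite -[r]CodeSeq.codeK e.
  by rewrite -hr er /= name1E size_poly1.
pose beta v := if v is v'.+1 then
  val_poly N polyC (fun _ => 'X) (name0 N) (CodeSeq.decode (snth h v)) else 'X.
have betaz v : (0 < v < V)%N -> poly_eval iota z (beta v) = b v.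
  case: v => //= v lt.
  by rewrite snth_mkseq // CodeSeq.codeK hl.
(* The term ring is nontrivial only for a consistent theory; interpreting t as z shows
   consistency. *)
have cons : ~ der N (lower_eq N n s (ncode r) h) (tbool N true) (tbool N false).
  pose b' := poly_eval iota z \o beta.
  move=> hd; have : value N n s iota b' (tbool N true) = value N n s iota b' (tbool N false).
    apply: val_der hd => x y [|[[-> ->]|[v [-> ->]]]]; first exact: val_def.
      rewrite val_vpoly val_tbool CodeSeq.codeK; apply: etrans pz.
      by rewrite -hr -poly_eval_val_poly /b' /= poly_evalX.
    by rewrite val_vbase val_vpoly -poly_eval_val_poly /b' /= poly_evalX.
  by rewrite !val_tbool => /eqP; rewrite oner_eq0.
have [A [c [phi [hc hD hM hE]]]] := ring_model cons.
pose t := phi (vbase 0).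
have hphi x y : def_eq N n s x y -> phi x = phi y.
  by move=> hxy; apply/hE/der_hyp; left.
have hpoly e u : poly_eval c t (val_poly N polyC (fun _ => 'X) e (CodeSeq.decode u))
    = phi (vpoly e u).
  rewrite (phi_vpoly (b := fun v => phi (vbase v)) hc hD hM (fun _ => erefl) hphi).
  exact: (poly_eval_val_poly N c (fun v => phi (vbase v))).
have phib v : phi (vbase v) = poly_eval c t (beta v).
  case: v => [|v]; first by rewrite poly_evalX.
  by rewrite /beta hpoly; apply/hE/der_hyp; right; right; exists v.
have pt : poly_eval c t p = 0.
  rewrite -hr -[r]CodeSeq.codeK hpoly.
  have -> : phi (vpoly (name1 N) (ncode r)) = phi (tbool N false).
    by apply/hE/der_hyp; right; left.
  by rewrite hc name0E rmorph0.
move=> x y hxy; apply/hE.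
have [px py] := phi_con (b := fun v => phi (vbase v)) hc hD hM (fun _ => erefl) hphi hxy.
have eb : (fun v => phi (vbase v)) = poly_eval c t \o beta by apply: funext => v; exact: phib.
have [vx vy] := rmorph_val_con (f := poly_eval c t) (poly_evalC c t) beta hxy.
have [wx wy] := rmorph_val_con (f := poly_eval iota z) (poly_evalC iota z) beta hxy.
have [lx ly] : value N n s iota (poly_eval iota z \o beta) x = value N n s iota b x /\
    value N n s iota (poly_eval iota z \o beta) y = value N n s iota b y.
  by apply: hV hxy => v; exact: betaz.
have [u hu] : exists u, value N n s polyC beta x - value N n s polyC beta y = u * p.
  by apply: pdvd; rewrite rmorphB /= wx wy lx ly (sol _ _ hxy) subrr.
have : poly_eval c t (value N n s polyC beta x - value N n s polyC beta y) = 0.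
  by rewrite hu rmorphM /= pt mulr0.
by rewrite rmorphB /= vx vy px py eb => /eqP; rewrite subr_eq0 => /eqP.
Qed.

End PrimitiveElement.
(** * Independence of inequivalent irreducible representations *)

Section Combinations.

Variables (k : fieldType) (F : closedFieldType) (iota : {rmorphism k -> F}).
Variables (n s : nat) (fs : seq (free_alg k s)).
Local Notation R := (quot_alg fs).
Local Notation rep := (representation iota n.+1 fs).
Implicit Types (rho : rep) (c d : seq (F * R)).

(** Lists of pairs stand for elements of the tensor product of F and R, on which all representations
    are evaluated simultaneously. *)
Definition comb rho c : 'M[F]_n.+1 := \sum_(t <- c) t.1 *: rho t.2.

Definition comb_mul c d : seq (F * R) :=
  [seq (t.1 * u.1, t.2 * u.2) | t <- c, u <- d].

Definition comb_scale (a : F) c : seq (F * R) := [seq (a * t.1, t.2) | t <- c].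

Lemma comb_cat rho c d : comb rho (c ++ d) = comb rho c + comb rho d.
Proof. by rewrite /comb big_cat. Qed.

Lemma comb_mulE rho c d : comb rho (comb_mul c d) = comb rho c *m comb rho d.
Proof.
rewrite /comb /comb_mul big_allpairs_dep /= mulmx_suml.
apply: eq_bigr => t _; rewrite mulmx_sumr; apply: eq_bigr => u _.
by rewrite rmorphM -scalemxAr -scalemxAl scalerA mulrC.
Qed.

Lemma comb_scaleE rho a c : comb rho (comb_scale a c) = a *: comb rho c.
Proof.
rewrite /comb /comb_scale big_map scaler_sumr.
by apply: eq_bigr => t _; rewrite scalerA.
Qed.

Lemma comb1 rho x : comb rho [:: (1, x)] = rho x.
Proof. by rewrite /comb big_seq1 scale1r. Qed.

Lemma comb_sum rho (I : finType) (a : I -> F) (e : I -> seq (F * R)) :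
  comb rho (flatten [seq comb_scale (a i) (e i) | i <- enum I])
    = \sum_i a i *: comb rho (e i).
Proof.
rewrite -big_enum /=; elim: (enum I) => [|i r IHr] /=.
  by rewrite big_nil /comb big_nil.
by rewrite comb_cat comb_scaleE IHr big_cons.
Qed.

(* If every combination killed by rho' is killed by rho, then the matrix units
   of rho' are mapped to a system of matrix units F_ij; for a vector v with
   F_00 v != 0 the matrix with columns F_i0 v intertwines rho' and rho. *)
Lemma rep_separation rho rho' : rep_irreducible rho -> rep_irreducible rho' ->
    ~ rep_equiv rho' rho ->
  exists2 c, comb rho c = 1%:M & comb rho' c = 0.
Proof.
move=> irr irr' neq.
have [[c [c0 c1]]|hker] := pselect (exists c, comb rho' c = 0 /\ comb rho c != 0).
  (* A combination c killed by rho' whose entry (a, b) under rho is nonzero yields the identity: it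
     is the sum over i of the products e_ia c e_bi, divided by that entry, with the matrix units
     lifted to combinations. *)
  have [a [b ab]] : exists a b, comb rho c a b != 0.
    apply: contrapT => h; case/eqP: c1; apply/matrixP => a b; rewrite [RHS]mxE.
    by apply: contrapT => hab; apply: h; exists a, b; apply/eqP.
  have /choice[l hl] i : exists l, comb rho l = delta_mx i a.
    by have [l ->] := irr (delta_mx i a); exists l.
  have /choice[r hr] i : exists r, comb rho r = delta_mx b i.
    by have [r ->] := irr (delta_mx b i); exists r.
  exists (flatten [seq comb_scale (comb rho c a b)^-1
      (comb_mul (l i) (comb_mul c (r i))) | i <- enum 'I_n.+1]).
    rewrite comb_sum; apply/matrixP => i j; rewrite summxE.
    rewrite (bigD1 i) //= big1 ?addr0 => [|i' ne].
      rewrite mxE !comb_mulE hl hr mxE (bigD1 a) //= big1 => [|a' /negPf ne].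
        rewrite !mxE !eqxx /= mul1r addr0 (bigD1 b) //= big1 => [|b' /negPf ne].
          by rewrite !mxE eqxx /= addr0 mulrA mulVf // mul1r eq_sym.
        by rewrite !mxE ne mulr0.
      by rewrite !mxE ne andbF mul0r.
    rewrite mxE !comb_mulE hl hr mxE big1 ?mulr0 // => a' _.
    by rewrite !mxE eq_sym (negPf ne) mul0r.
  rewrite comb_sum big1 // => i _.
  by rewrite !comb_mulE c0 mul0mx mulmx0 scaler0.
have {}hker c : comb rho' c = 0 -> comb rho c = 0.
  by move=> h; apply/eqP/negPn/negP => h'; apply: hker; exists c.
have hsub c d : comb rho' c = comb rho' d -> comb rho c = comb rho d.
  move=> h; apply/eqP; rewrite -subr_eq0 -scaleN1r -comb_scaleE -comb_cat.
  by apply/eqP/hker; rewrite comb_cat comb_scaleE scaleN1r h subrr.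
have /choice[e he] (ij : 'I_n.+1 * 'I_n.+1) : exists e, comb rho' e = delta_mx ij.1 ij.2.
  by have [e ->] := irr' (delta_mx ij.1 ij.2); exists e.
pose U i j := comb rho (e (i, j)).
have UM i j j' l : U i j *m U j' l = (j == j')%:R *: U i l.
  rewrite /U -comb_mulE -comb_scaleE; apply: hsub.
  by rewrite comb_mulE comb_scaleE !he /= mul_delta_mx_cond scaler_nat.
have rhoE x : rho x = \sum_i \sum_j rho' x i j *: U i j.
  pose c := flatten [seq comb_scale (rho' x ij.1 ij.2) (e ij) |
    ij <- enum {: 'I_n.+1 * 'I_n.+1}].
  rewrite pair_big /=.
  transitivity (comb rho c); last first.
    by rewrite comb_sum; apply: eq_bigr => -[i j] _.
  rewrite -comb1; apply: hsub; rewrite comb1 comb_sum [LHS]matrix_sum_delta.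
  by rewrite pair_big /=; apply: eq_bigr => -[i j] _; rewrite he.
have U1 : \sum_i U i i = 1.
  rewrite -(rmorph1 rho) rhoE rmorph1; apply: eq_bigr => i _.
  rewrite (bigD1 i) //= big1 => [|j /negPf ne]; rewrite mxE ?eqxx ?scale1r ?addr0 //.
  by rewrite eq_sym ne scale0r.
have U00 : U 0 0 != 0.
  apply: contraNneq (oner_neq0 'M[F]_n.+1) => U0; rewrite -U1 big1 // => i _.
  have := UM i 0 0 i; rewrite eqxx scale1r => <-.
  have := UM i 0 0 0; rewrite eqxx scale1r => <-.
  by rewrite U0 mulmx0 mul0mx.
have [a0 [b0 ab0]] : exists a b, U 0 0 a b != 0.
  apply: contrapT => h; case/eqP: U00; apply/matrixP => a b; rewrite [RHS]mxE.
  by apply: contrapT => hab; apply: h; exists a, b; apply/eqP.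
pose Q : 'M[F]_n.+1 := \matrix_(i, j) U j 0 i b0.
have UQ i j : U i j *m Q = Q *m delta_mx i j.
  apply/matrixP => a l; rewrite [RHS]mxE (bigD1 i) //= big1 => [|i' /negPf ne].
    have := f_equal (fun X : 'M[F]_n.+1 => X a b0) (UM i j l 0).
    rewrite !mxE eqxx addr0 /= => e1; rewrite mulrC eq_sym -e1.
    by apply: eq_bigr => y _; rewrite mxE.
  by rewrite !mxE ne mulr0.
have Qunit : Q \in unitmx.
  (* The inverse of Q comes from the same nonzero entry of [U 0 0]: row j of P is row a0 of [U 0 j],
     scaled. *)
  pose P : 'M[F]_n.+1 := \matrix_(j, l) ((U 0 0 a0 b0)^-1 * U 0 j a0 l).
  have /mulmx1_unit[] // : P *m Q = 1%:M.
  apply/matrixP => i l; rewrite mxE.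
  have := f_equal (fun X : 'M[F]_n.+1 => X a0 l) (UQ 0 i); rewrite mxE => e1.
  transitivity ((U 0 0 a0 b0)^-1 * \sum_j U 0 i a0 j * Q j l).
    by rewrite mulr_sumr; apply: eq_bigr => j _; rewrite [in LHS]mxE mulrA.
  rewrite e1 mxE (bigD1 0) //= big1 => [|j /negPf ne]; last by rewrite !mxE ne mulr0.
  by rewrite !mxE eqxx addr0 /= mulrA mulVf // mul1r eq_sym.
case: neq; exists Q => // x.
suff -> : Q *m rho' x = rho x *m Q by rewrite mulmxK.
rewrite rhoE {1}[rho' x]matrix_sum_delta mulmx_sumr mulmx_suml.
apply: eq_bigr => i _; rewrite mulmx_sumr mulmx_suml; apply: eq_bigr => j _.
by rewrite -scalemxAr -scalemxAl UQ.
Qed.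

(** As in the Chinese remainder theorem, the product over q of combinations separating p from q is 1
    at p and 0 elsewhere; irreducibility at p then gives B. *)
Lemma rep_family_dense m (rho : 'I_m -> rep) : (forall p, rep_irreducible (rho p)) ->
    (forall p q, p != q -> ~ rep_equiv (rho p) (rho q)) ->
  forall p (B : 'M[F]_n.+1), exists c, comb (rho p) c = B /\
    forall q, q != p -> comb (rho q) c = 0.
Proof.
move=> irr neq p B.
suff [c [c1 c0]] : exists c, comb (rho p) c = 1%:M /\
    forall q, q \in [seq q <- enum 'I_m | q != p] -> comb (rho q) c = 0.
  have [d ->] := irr p B; exists (comb_mul c d).
  rewrite comb_mulE c1 mul1mx; split=> // q qp.
  by rewrite comb_mulE c0 ?mul0mx // mem_filter qp mem_enum.
elim: (enum 'I_m) => [|q r [c [c1 c0]]] /=.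
  by exists [:: (1, 1)]; rewrite comb1 rmorph1.
case: ifP => [qp|_]; last by exists c.
have [d d1 d0] := rep_separation (irr p) (irr q) (neq _ _ qp).
exists (comb_mul d c); rewrite comb_mulE d1 c1 mul1mx; split=> // q'.
rewrite inE => /orP[/eqP ->|/c0 e]; first by rewrite comb_mulE d0 mul0mx.
by rewrite comb_mulE e mulmx0.
Qed.

End Combinations.
(** * Solutions and tuples of representations *)

Section WordsOfFreeAlgebra.

Variables (k : fieldType) (N : naming k) (s : nat).

(** The value 0 outside the alphabet matches [def_word_out]. *)
Definition xgen (a : nat) : free_alg k s :=
  if insub a is Some i then << FMonom [:: i] >> else 0.

Definition wordelt (w : seq nat) : free_alg k s := \prod_(a <- w) xgen a.

Lemma xgen_out a : (s <= a)%N -> xgen a = 0.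
Proof. by move=> le; rewrite /xgen insubF // ltnNge le. Qed.

Lemma wordelt_cons a w : wordelt (a :: w) = xgen a * wordelt w.
Proof. by rewrite /wordelt big_cons. Qed.

Lemma wordelt_ord (w : seq 'I_s) : wordelt (map val w) = << FMonom w >>.
Proof.
elim: w => [|a w IHw].
  rewrite /wordelt big_nil; transitivity (<< (@mone _ : {fmonom 'I_s}) >> : free_alg k s) => //.
  by congr << _ >>; apply/val_inj; rewrite /= fm1.
rewrite map_cons wordelt_cons IHw /xgen valK.
rewrite -[LHS]/(fgmul << FMonom [:: a] >> << FMonom w >>) fgmulUU mulr1.
by congr << _ >>; apply/val_inj; rewrite /= fmM.
Qed.

Lemma monalg_scale (c : k) (m : {fmonom 'I_s}) : << c *g m >> = c *: (<< m >> : free_alg k s).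
Proof. by apply/malgP => m'; rewrite mcoeffZ !mcoeffU mulr_natr. Qed.

Lemma alg_namedE (d : alg_name s) :
  alg_named N d = \sum_(t <- d) N t.1 *: wordelt (map val t.2).
Proof. by apply: eq_bigr => t _; rewrite monalg_scale wordelt_ord. Qed.

Lemma free_algE (x : free_alg k s) :
  x = \sum_(m <- msupp x) x@_m *: wordelt (map val (m : seq 'I_s)).
Proof.
by rewrite [LHS]monalgE; apply: eq_bigr => m _; rewrite monalg_scale wordelt_ord fmK.
Qed.

End WordsOfFreeAlgebra.

Section WordValues.

Variables (k : fieldType) (N : naming k) (F : closedFieldType) (iota : {rmorphism k -> F}).
Variables (n s : nat) (g : {rmorphism free_alg k s -> 'M[F]_n.+1}).
Hypothesis gZ : forall a x, g (a *: x) = iota a *: g x.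
Variables (b : nat -> F) (p : nat).
Hypothesis hb : forall a (i j : 'I_n.+1), (a < s)%N ->
  b (ient p a i j) = g (xgen k s a) i j.

Lemma val_word_rep w (i j : 'I_n.+1) :
  val_word n.+1 s b p w i j = g (wordelt k s w) i j.
Proof.
elim: w i => [|a w IHw] i /=.
  by rewrite /wordelt big_nil rmorph1 mxE.
rewrite wordelt_cons rmorphM mxE /=; case: ltnP => [lt|le].
  by apply: eq_bigr => l _; rewrite hb // IHw.
by rewrite big1 // => l _; rewrite xgen_out // rmorph0 mxE mul0r.
Qed.

Lemma val_rel_rep (d : alg_name s) (i j : 'I_n.+1) :
  val_rel N n.+1 s iota b p (CodeSeq.decode (alg_code d)) i j = g (alg_named N d) i j.
Proof.
rewrite /alg_code /ncode2 CodeSeq.codeK /val_rel !big_map alg_namedE.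
rewrite rmorph_sum summxE; apply: eq_bigr => t _.
rewrite ncode_cons !sE CodeSeq.codeK (val_word_rep (map val t.2)) /=.
by rewrite gZ mxE.
Qed.

End WordValues.

Section MatrixRepresentation.

Variables (k : fieldType) (F : closedFieldType) (iota : {rmorphism k -> F}).
Variables (n s : nat) (M : 'I_s -> 'M[F]_n.+1).

Definition monom_mx (m : {fmonom 'I_s}) : 'M[F]_n.+1 := \prod_(a <- (m : seq 'I_s)) M a.

Lemma monom_mx_mmorphism : mmorphism monom_mx.
Proof.
by split=> [x y|]; rewrite /monom_mx ?fmM ?big_cat // fm1 big_nil.
Qed.

HB.instance Definition _ := isMultiplicative.Build _ _ monom_mx monom_mx_mmorphism.

Definition eval_mx : free_alg k s -> 'M[F]_n.+1 :=
  mmap (@scalar_mx F n.+1 \o iota) monom_mx.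

Lemma eval_mx_zmod : zmod_morphism eval_mx.
Proof. exact: mmap_is_additive. Qed.

Lemma eval_mx_monoid : monoid_morphism eval_mx.
Proof.
have [h1 h2] := @commr_mmap_is_multiplicative _ k 'M[F]_n.+1
  (@scalar_mx F n.+1 \o iota) monom_mx
  (fun g m m' => esym (scalar_mxC _ _)).
by split.
Qed.

HB.instance Definition _ := GRing.isZmodMorphism.Build _ _ eval_mx eval_mx_zmod.
HB.instance Definition _ := GRing.isMonoidMorphism.Build _ _ eval_mx eval_mx_monoid.

Lemma eval_mxZ a x : eval_mx (a *: x) = iota a *: eval_mx x.
Proof.
by rewrite /eval_mx (@mmapZ _ _ _ (@scalar_mx F n.+1 \o iota) monom_mx) -mul_scalar_mx.
Qed.

Lemma eval_mx_xgen (i : 'I_s) : eval_mx (xgen k s i) = M i.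
Proof.
rewrite /xgen valK /eval_mx mmapU /= rmorph1 mul1r /monom_mx.
by rewrite big_cons big_nil mulr1.
Qed.

Variable fs : seq (free_alg k s).
Hypothesis kills : forall f, f \in fs -> eval_mx f = 0.

Definition quot_mx (x : quot_alg fs) : 'M[F]_n.+1 := eval_mx (repr x).

Lemma quot_mxE x : quot_mx (qproj fs x) = eval_mx x.
Proof.
apply/eqP; rewrite -subr_eq0 -rmorphB; apply/eqP.
have /ideal_ofP[c hc ->] : repr (qproj fs x) - x \in ideal_of fs.
  by apply/qproj_eq; rewrite qprojK.
rewrite rmorph_sum big_seq big1 // => t /hc ht.
by rewrite !rmorphM /= (kills ht) mulr0 mul0r.
Qed.

Lemma quot_mx_zmod : zmod_morphism quot_mx.
Proof.
by move=> x y; rewrite -[x]qprojK -[y]qprojK -raddfB !quot_mxE rmorphB.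
Qed.

Lemma quot_mx_monoid : monoid_morphism quot_mx.
Proof.
split=> [|x y]; first by rewrite -[1]/(qproj fs 1) quot_mxE rmorph1.
by rewrite -[x]qprojK -[y]qprojK -rmorphM !quot_mxE rmorphM.
Qed.

HB.instance Definition _ := GRing.isZmodMorphism.Build _ _ quot_mx quot_mx_zmod.
HB.instance Definition _ := GRing.isMonoidMorphism.Build _ _ quot_mx quot_mx_monoid.

Lemma quot_mx_scalable : scalable_for (iota \; *:%R) quot_mx.
Proof.
move=> a x; rewrite -[x]qprojK -[a *: _]/(qscale a _) -qprojZ !quot_mxE.
exact: eval_mxZ.
Qed.

Definition rep_of_matrices : representation iota n.+1 fs :=
  Representation (rep_fun := quot_mx) quot_mx_scalable.

Lemma rep_of_matricesE x : rep_of_matrices (qproj fs x) = eval_mx x.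
Proof. exact: quot_mxE. Qed.

End MatrixRepresentation.
Section SolutionsAndRepresentations.

Variables (k : fieldType) (N : naming k) (F : closedFieldType) (iota : {rmorphism k -> F}).
Variables (n s : nat) (ds : seq (alg_name s)).

Local Notation fs := [seq alg_named N d | d <- ds].
Local Notation dsc := (ncode [seq alg_code d | d <- ds]).
Local Notation rep := (representation iota n.+1 fs).

Definition independent_reps m (rho : 'I_m -> rep) : Prop :=
  (forall p, rep_irreducible (rho p)) /\
  (forall p q, p != q -> ~ rep_equiv (rho p) (rho q)).

Lemma rep_alg_scale (rho : rep) a x :
  rho (qproj fs (a *: x)) = iota a *: rho (qproj fs x).
Proof. by rewrite qprojZ; exact: rep_scale. Qed.

Lemma unit_index_inj p i j p' i' j' :
  (unit_index p i j == unit_index p' i' j') = [&& p == p', i == i' & j == j'].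
Proof.
apply/eqP/and3P => [/scons_inj[-> /scons_inj[-> ->]] //|[/eqP -> /eqP -> /eqP ->] //].
Qed.

Lemma solution_reps m b : solution N n.+1 s iota b dsc m ->
  exists rho : 'I_m -> rep, independent_reps rho.
Proof.
move=> sol; pose M (p : 'I_m) (a : 'I_s) : 'M[F]_n.+1 :=
  \matrix_(i, j) b (ient p a i j).
have hb (p : 'I_m) a (i j : 'I_n.+1) : (a < s)%N ->
    b (ient p a i j) = eval_mx iota (M p) (xgen k s a) i j.
  by move=> lt; rewrite (eval_mx_xgen iota (M p) (Ordinal lt)) mxE.
have kills (p : 'I_m) f : f \in fs -> eval_mx iota (M p) f = 0.
  move=> /mapP[d dds ->]; apply/matrixP => i j.
  rewrite -(val_rel_rep N (eval_mxZ iota (M p)) (hb p)) -val_vrel mxE.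
  have lt : (index d ds < size ds)%N by rewrite index_mem.
  have := @con_rel _ N n.+1 s dsc m (index d ds) p i j.
  rewrite iter_stl snthE CodeSeq.codeK (nth_map d) // nth_index // => h.
  rewrite (sol _ _ (h _ _ _ _)) ?val_tbool //.
  rewrite (drop_nth 0%N) ?size_map // ncode_cons scons_neq0 //.
pose rho p := rep_of_matrices (kills p).
pose B := word_bound n.+1 s m.
have hsum (p' : 'I_m) (i' j' : 'I_n.+1) (p : 'I_m) :
    \sum_(u < B) b (icoef (unit_index p' i' j') u) *:
      rho p (qproj fs (wordelt k s (CodeSeq.decode u)))
    = (p' == p)%:R *: delta_mx i' j'.
  apply/matrixP => i j; rewrite summxE !mxE.
  have := @con_sum _ N n.+1 s dsc m p' i' j' p i j.
  move=> /(_ (ltn_ord _) (ltn_ord _) (ltn_ord _) (ltn_ord _) (ltn_ord _) (ltn_ord _)).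
  move=> /sol; rewrite val_vsum val_tbool unit_index_inj /val_sum => e.
  transitivity ([&& p' == p, i' == i & j' == j]%:R : F).
    rewrite -e; apply: eq_bigr => u _; rewrite mxE; congr (_ * _).
    by rewrite rep_of_matricesE (val_word_rep (hb p)).
  by rewrite -natrM mulnb ![i' == _]eq_sym ![j' == _]eq_sym.
exists rho; split=> [p X|p p' ne [Q Qu hQ]].
  exists [seq (\sum_i \sum_j X i j * b (icoef (unit_index p i j) u),
    qproj fs (wordelt k s (CodeSeq.decode u))) | u : 'I_B <- enum 'I_B].
  rewrite big_map big_enum /= [LHS]matrix_sum_delta.
  transitivity (\sum_i \sum_j \sum_(u < B) (X i j * b (icoef (unit_index p i j) u)) *:
     rho p (qproj fs (wordelt k s (CodeSeq.decode u)))).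
    apply: eq_bigr => i _; apply: eq_bigr => j _.
    have := hsum p i j p; rewrite eqxx scale1r => <-.
    by rewrite scaler_sumr; apply: eq_bigr => u _; rewrite scalerA.
  rewrite exchange_big /=; under eq_bigr do rewrite exchange_big /=.
  rewrite exchange_big /=; apply: eq_bigr => u _.
  rewrite scaler_suml exchange_big; apply: eq_bigr => i _.
  by rewrite scaler_suml.
(* The combination for a matrix unit at p is zero at p' and nonzero at p, which conjugation by Q
   excludes. *)
have := hsum p 0 0 p'; rewrite (negPf ne) scale0r.
have := hsum p 0 0 p; rewrite eqxx scale1r => e1.
under eq_bigr do rewrite hQ scalemxAl scalemxAr.
rewrite -mulmx_suml -mulmx_sumr e1 => /(f_equal (fun Y => invmx Q *m Y *m Q)).
rewrite mulmx0 mul0mx -!mulmxA mulVmx // mulmx1 mulKmx //.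
by move=> /matrixP/(_ 0 0)/eqP; rewrite !mxE !eqxx oner_eq0.
Qed.

(** * Words of bounded length span the product of matrix algebras *)

Section Density.

Variables (m : nat) (rho : 'I_m -> rep).

Local Notation A := {ffun 'I_m -> 'M[F]_n.+1}.

Definition rep_vec (x : free_alg k s) : A := [ffun p => rho p (qproj fs x)].

Lemma rep_vec0 : rep_vec 0 = 0.
Proof. by apply/ffunP => p; rewrite !ffunE !raddf0. Qed.

Lemma rep_vec_sum (I : Type) (r : seq I) (a : I -> k) (x : I -> free_alg k s) :
  rep_vec (\sum_(i <- r) a i *: x i) = \sum_(i <- r) iota (a i) *: rep_vec (x i).
Proof.
apply/ffunP => p; rewrite sum_ffunE !ffunE !raddf_sum.
by apply: eq_bigr => i _; rewrite !ffunE; exact: rep_alg_scale.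
Qed.

Definition lmul_vec (x : free_alg k s) (v : A) : A :=
  [ffun p => rho p (qproj fs x) *m v p].

Lemma lmul_vec_linear x : linear (lmul_vec x).
Proof.
move=> a u v; apply/ffunP => p; rewrite !ffunE mulmxDr.
by rewrite -scalemxAr.
Qed.

HB.instance Definition _ x :=
  GRing.isLinear.Build F A A *:%R (lmul_vec x) (lmul_vec_linear x).

Lemma lmul_rep_vec x y : lmul_vec x (rep_vec y) = rep_vec (x * y).
Proof. by apply/ffunP => p; rewrite !ffunE rmorphM rmorphM. Qed.

Fixpoint words (l : nat) : seq (seq nat) :=
  if l is l'.+1 then [::] :: [seq a :: w | a <- seq.iota 0 s, w <- words l']
  else [:: [::]].
Arguments words : simpl never.

Lemma in_wordsS l w : (w \in words l.+1) =
  (w == [::]) || (w \in [seq a :: u | a <- seq.iota 0 s, u <- words l]).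
Proof. by []. Qed.

Definition word_span (l : nat) : {vspace A} :=
  <<[seq rep_vec (wordelt k s w) | w <- words l]>>%VS.

Lemma nil_words l : [::] \in words l.
Proof. by case: l => [|l]; rewrite inE eqxx. Qed.

Lemma sub_words l : {subset words l <= words l.+1}.
Proof.
elim: l => [|l IHl] w; first by rewrite inE => /eqP ->; rewrite nil_words.
rewrite in_wordsS => /orP[/eqP ->|/allpairsP[[a u] /= [ha hu ->]]].
  exact: nil_words.
rewrite in_wordsS; apply/orP; right; apply/allpairsP; exists (a, u).
by split=> //; exact: IHl.
Qed.

Lemma word_span_step l : (word_span l <= word_span l.+1)%VS.
Proof.
by apply: sub_span => v /mapP[w hw ->]; apply/mapP; exists w; rewrite // sub_words.
Qed.

Lemma mem_word_span l w : w \in words l -> rep_vec (wordelt k s w) \in word_span l.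
Proof. by move=> hw; apply/memv_span/mapP; exists w. Qed.

(** If the span stops growing at l, left multiplication by a generator maps it into the span at l +
    1, hence into itself. *)
Lemma word_span_stable l : (word_span l.+1 <= word_span l)%VS ->
  forall w, rep_vec (wordelt k s w) \in word_span l.
Proof.
move=> st; elim=> [|a w IHw]; first exact/mem_word_span/nil_words.
rewrite wordelt_cons; case: (ltnP a s) => [lt|le]; last first.
  by rewrite xgen_out // mul0r rep_vec0 mem0v.
apply: (subvP st); rewrite -lmul_rep_vec.
have := memv_img (linfun (lmul_vec (xgen k s a))) IHw.
rewrite lfunE /= /word_span limg_span -map_comp; apply/subvP/sub_span => v.
move=> /mapP[u hu ->]; rewrite /= lfunE /= lmul_rep_vec -wordelt_cons.
rewrite inE; apply/orP; right; apply/mapP; exists (a :: u) => //.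
by apply/allpairsP; exists (a, u); rewrite /= mem_iota.
Qed.

(** Otherwise the dimension would grow at [m * (n.+1 * n.+1)] + 1 consecutive steps and exceed that
    of the space. *)
Lemma word_span_stable_exists : exists2 l, (l <= m * (n.+1 * n.+1))%N &
  (word_span l.+1 <= word_span l)%VS.
Proof.
apply: contrapT => h.
suff main l : (l <= (m * (n.+1 * n.+1)).+1)%N -> (l <= \dim (word_span l))%N.
  have dA : dim A = (m * (n.+1 * n.+1))%N by rewrite /dim /= card_ord.
  have := dimvS (subvf (word_span (m * (n.+1 * n.+1)).+1)).
  by rewrite dimvf dA leqNgt (main _ (leqnn _)).
elim: l => // l IHl lt; apply: leq_ltn_trans (IHl (ltnW lt)) _.
rewrite ltn_neqAle dimvS ?word_span_step // andbT.
apply/negP => /eqP e; apply: h; exists l => //.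
by have /dimv_leqif_sup/geq_leqif <- := word_span_step l; rewrite e.
Qed.

(** [scons] is monotone in both arguments, so the worst case is the word made of l letters s. *)
Lemma words_code l w : w \in words l -> (ncode w <= iter l (scons s) 0)%N.
Proof.
elim: l w => [|l IHl] w; first by rewrite inE => /eqP ->.
rewrite in_wordsS => /orP[/eqP -> //|/allpairsP[[a u] /= [ha hu ->]]].
rewrite mem_iota /= in ha.
rewrite ncode_cons !scons_unlock leq_mul //.
  by rewrite leq_exp2l // ltnW.
by rewrite ltnS leq_double IHl.
Qed.

Lemma iter_scons_mono l l' : (l <= l')%N -> (iter l (scons s) 0 <= iter l' (scons s) 0)%N.
Proof.
move=> /subnK <-; elim: (l' - l)%N => //= d IHd; apply: leq_trans IHd _.
exact/ltnW/ltn_scons_tl.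
Qed.

Hypothesis indep : independent_reps rho.

(** The stable span contains the image of every word, so of the whole free algebra, and
    [rep_family_dense] then provides each factor of the product. *)
Lemma word_codes_span (v : A) : v \in <<[tuple rep_vec (wordelt k s (CodeSeq.decode u))
  | u < word_bound n.+1 s m]>>%VS.
Proof.
have [l lel /word_span_stable st] := word_span_stable_exists.
have sub : (word_span l <= <<[tuple rep_vec (wordelt k s (CodeSeq.decode u))
  | u < word_bound n.+1 s m]>>)%VS.
  apply: sub_span => x /mapP[w hw ->].
  have lt : (ncode w < word_bound n.+1 s m)%N.
    rewrite /word_bound ltnS (leq_trans (words_code hw)) //.
    by apply: iter_scons_mono; rewrite (leq_trans lel) // !leqW.
  apply/mapP; exists (Ordinal lt); rewrite ?mem_enum //=.
  by rewrite CodeSeq.codeK.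
apply: (subvP sub) => {sub}.
have alg x : rep_vec x \in word_span l.
  by rewrite [x]free_algE rep_vec_sum rpred_sum // => i _; rewrite rpredZ.
have irr_mem p (B : 'M[F]_n.+1) : [ffun q => if q == p then B else 0] \in word_span l.
  have [c [cp cq]] := rep_family_dense indep.1 indep.2 p B.
  have -> : [ffun q => if q == p then B else 0]
      = \sum_(t <- c) t.1 *: rep_vec (repr t.2) :> A.
    apply/ffunP => q; rewrite sum_ffunE ffunE; transitivity (comb (rho q) c).
      by case: eqP => [->|/eqP /cq ->].
    by apply: eq_bigr => t _; rewrite !ffunE qprojK.
  by rewrite rpred_sum // => t _; rewrite rpredZ.
have -> : v = \sum_p [ffun q => if q == p then v p else 0].
  apply/ffunP => q; rewrite sum_ffunE (bigD1 q) //= big1 => [|p /negPf ne].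
    by rewrite ffunE eqxx addr0.
  by rewrite ffunE eq_sym ne.
by rewrite rpred_sum.
Qed.

Lemma reps_solution : exists b, solution N n.+1 s iota b dsc m.
Proof.
pose B := word_bound n.+1 s m.
pose X := [tuple rep_vec (wordelt k s (CodeSeq.decode u)) | u < B].
pose E (p i j : nat) : A := [ffun q : 'I_m => if (q : nat) == p then
  delta_mx (inord i) (inord j) else 0].
pose D p i j u := if insub u is Some u' then coord X u' (E p i j) else 0.
pose G (p a i j : nat) : F := if insub p is Some p' then
  rho p' (qproj fs (xgen k s a)) (inord i) (inord j) else 0.
(* [b] undoes the coding of [ient] and [icoef]: entries of the given matrices at head 0, and
   otherwise coordinates of a matrix unit in the spanning family [X], which may be linearly
   dependent. *)
pose b v := let x := stl v in
  if shd v == 0%N then G (shd x) (shd (stl x)) (shd (stl (stl x))) (stl (stl (stl x)))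
  else D (shd (shd x)) (shd (stl (shd x))) (stl (stl (shd x))) (stl x).
have hb (p : 'I_m) a (i j : 'I_n.+1) : (a < s)%N ->
    b (ient p a i j) = (rho p \o qproj fs) (xgen k s a) i j.
  by move=> _; rewrite /b /ient !sE /= /G valK !inord_val.
have gZ p a x : (rho p \o qproj fs) (a *: x) = iota a *: (rho p \o qproj fs) x.
  exact: rep_alg_scale.
have hD (p i j u : nat) : b (icoef (unit_index p i j) u) = D p i j u.
  by rewrite /b /icoef /unit_index !sE.
exists b => x y [t p i j ht hp hi hj|p' i' j' p i j hp' hi' hj' hp hi hj].
  have lt : (t < size ds)%N.
    rewrite ltnNge; apply: contraNN ht => le; rewrite iter_stl CodeSeq.codeK.
    by rewrite drop_oversize // size_map.
  rewrite val_vrel val_tbool snthE CodeSeq.codeK (nth_map [::]) //.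
  rewrite (val_rel_rep N (gZ (Ordinal hp)) (hb (Ordinal hp)) _ (Ordinal hi) (Ordinal hj)).
  rewrite /= (_ : qproj _ _ = 0) ?raddf0 ?mxE //.
  rewrite -(raddf0 (qproj fs)); apply/qproj_eq; rewrite subr0.
  apply/ideal_ofP; exists [:: (1, alg_named N (nth [::] ds t), 1)].
    by move=> u; rewrite inE => /eqP -> /=; apply: map_f; rewrite mem_nth.
  by rewrite big_seq1 /= mul1r mulr1.
rewrite val_vsum val_tbool /val_sum -/B unit_index_inj.
have := coord_span (word_codes_span (E p' i' j')).
move=> /(f_equal (fun v : A => v (Ordinal hp) (Ordinal hi) (Ordinal hj))).
rewrite sum_ffunE summxE !ffunE => e.
transitivity ((if p == p' then delta_mx (inord i') (inord j') else 0 : 'M[F]_n.+1)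
   (Ordinal hi) (Ordinal hj)); last first.
  rewrite [p' == p]eq_sym; case: eqP => _; rewrite mxE //=.
  rewrite -!val_eqE /= !inordK // [i' == i]eq_sym [j' == j]eq_sym.
  by [].
rewrite e; apply: eq_bigr => u _.
rewrite hD /D valK (val_word_rep (hb (Ordinal hp)) _ (Ordinal hi) (Ordinal hj)).
by rewrite !ffunE mxE; congr (_ * _); rewrite (nth_map u) ?nth_ord_enum ?ffunE ?size_enum_ord.
Qed.

End Density.

End SolutionsAndRepresentations.

(** * Counting equivalence classes *)

Section CountingClasses.

Variables (k : fieldType) (N : naming k) (F : closedFieldType) (iota : {rmorphism k -> F}).
Variables (n s : nat) (ds : seq (alg_name s)).
Local Notation fs := [seq alg_named N d | d <- ds].
Implicit Types (rho : representation iota n.+1 fs).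

Lemma rep_equiv_refl rho : rep_equiv rho rho.
Proof. by exists 1%:M; rewrite ?unitmx1 // => x; rewrite invmx1 mulmx1 mul1mx. Qed.

Lemma rep_equiv_sym rho rho' : rep_equiv rho rho' -> rep_equiv rho' rho.
Proof.
move=> [Q Qu hQ]; exists (invmx Q) => [|x]; first by rewrite unitmx_inv.
by rewrite hQ invmxK -!mulmxA mulVmx // mulmx1 mulKmx.
Qed.

Lemma rep_equiv_trans rho1 rho2 rho3 :
  rep_equiv rho1 rho2 -> rep_equiv rho2 rho3 -> rep_equiv rho1 rho3.
Proof.
move=> [Q Qu hQ] [P Pu hP]; exists (P *m Q) => [|x]; first by rewrite unitmx_mul Pu.
have -> : invmx (P *m Q) = invmx Q *m invmx P.
  rewrite -[invmx Q]mul1mx.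
  apply: (canRL (mulmxK Pu)); apply: (canRL (mulmxK Qu)).
  by rewrite -mulmxA mulVmx ?unitmx_mul ?Pu.
by rewrite hP hQ !mulmxA.
Qed.

Definition rep_class rho : set (representation iota n.+1 fs) :=
  [set rho' | rep_equiv rho rho']%classic.

Lemma rep_class_eq rho rho' : rep_class rho = rep_class rho' <-> rep_equiv rho rho'.
Proof.
split=> [e|h].
  suff : rep_class rho rho' by [].
  by rewrite e; exact: rep_equiv_refl.
apply/seteqP; split=> r /= hr.
  by apply: rep_equiv_trans hr; exact: rep_equiv_sym.
exact: rep_equiv_trans h hr.
Qed.

Lemma independent_reps_card m : (exists rho : 'I_m -> representation iota n.+1 fs,
    independent_reps rho) <->
  (`I_m #<= irr_classes iota n.+1 fs)%card.
Proof.
split=> [[rho [irr neq]]|/pcard_leP[f]].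
  pose g p := if insub p is Some p' then rep_class (rho p') else set0.
  have ginj : {in `I_m &, injective g}.
    move=> p q /set_mem /= hp /set_mem /= hq; rewrite /g !insubT /= => /rep_class_eq h.
    apply/eqP/negPn/negP => pq; apply: neq h.
    by rewrite -val_eqE.
  rewrite -(card_le_eql (inj_card_eq ginj)); apply: subset_card_le => _ [p /= hp <-].
  by rewrite /g insubT /=; exists (rho (Sub p hp)).
have /choice[rho hrho] (p : 'I_m) : exists r, rep_irreducible r /\ f p = rep_class r.
  have := 'funS_f (ltn_ord p).
  by move=> [r hr e]; exists r.
exists rho; split=> [p|p q pq /rep_class_eq e]; first exact: (hrho p).1.
have ef : f p = f q by rewrite (hrho p).2 (hrho q).2.
have := 'inj_f (mem_set (ltn_ord p)) (mem_set (ltn_ord q)) ef.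
by move/val_inj => pq'; rewrite pq' eqxx in pq.
Qed.

Variables (char0 : [pchar k] =i pred0) (closure : is_alg_closure iota).
Local Notation dsc := (ncode [seq alg_code d | d <- ds]).

Lemma certified_card m : certified N n.+1 s dsc m <->
  (`I_m #<= irr_classes iota n.+1 fs)%card.
Proof.
rewrite -independent_reps_card; split.
  by move=> /(certified_solvable iota)[b]; exact: solution_reps.
by move=> [rho /reps_solution[b]]; exact: solvable_certified.
Qed.

Lemma refutable_card m : refutable N n.+1 s dsc m <->
  ~ (`I_m #<= irr_classes iota n.+1 fs)%card.
Proof.
rewrite -independent_reps_card; split=> [hr [rho /reps_solution[b]]|h].
  exact: refutable_unsolvable hr.
apply: (@unsolvable_refutable _ _ _ _ _ _ _ iota) => b /solution_reps.
exact: h.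
Qed.

End CountingClasses.
Theorem mainTheorem2 (n : nat) (n_gt0 : (0 < n)%N)
    (k : fieldType) (char0 : [pchar k]%R =i pred0)
    (nu : nat -> k) (k_computable : computable_field nu)
    (k_factoring : exists p, factoring_algorithm nu p)
    (kbar : closedFieldType) (iota : {rmorphism k -> kbar})
    (kbar_closure : is_alg_closure iota) :
  exists P : murec,
    forall (s : nat) (fs : seq (free_alg k s)) (ds : seq (alg_name s)),
      [seq alg_named nu d | d <- ds] = fs ->
      finite_set (irr_classes iota n fs) ->
      exists2 m : nat,
        eval P [:: s; ncode [seq alg_code d | d <- ds]] m &
        (irr_classes iota n fs #= `I_m)%card.

Proof.
case: n n_gt0 => // n' _; have [N eN] := naming_of_computable k_computable.
have [P hP] := counting_program N n'.+1; exists P => s fs ds; rewrite -eN => <-.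
move=> [M hM]; pose C m := (`I_m #<= irr_classes iota n'.+1 [seq alg_named N d | d <- ds])%card.
have CE m : C m = (m <= M)%N by rewrite /C (card_le_eqr hM) card_le_II.
have hcert m : certified N n'.+1 s (ncode [seq alg_code d | d <- ds]) m <-> (m <= M)%N.
  by rewrite -CE; exact: certified_card.
have href m : refutable N n'.+1 s (ncode [seq alg_code d | d <- ds]) m <-> ~ (m <= M)%N.
  by rewrite -CE; exact: refutable_card.
(* A certificate for m bounds it by M, and a refutation for m + 1 excludes m < M, so the search can
   only return M. *)
have [||m [hm /hcert le /href nlt]] := hP s (ncode [seq alg_code d | d <- ds]) M.
- exact/hcert.
- by apply/href; rewrite ltnn.
exists m => //; suff -> : m = M by [].
by apply/eqP; rewrite eqn_leq le leqNgt; apply/negP.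
Qed.
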